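(* Let $T$ be a bounded operator on a complex separable Banach space $X$ having type $p\in(1,2]$. Assume there is a finite constant $C$ such that for every nonempty open $\Omega\subset X$ with $T^{-1}(\Omega)\subset\Omega$, one can find a finite family $(u_k)_{k\in K}$ of unimodular eigenvectors of $T$ whose associated eigenvalues $(\lambda_k)_{k\in K}$ form an independent family, such that $\sum_k u_k\in\Omega$ and $\sum_k\|u_k\|^p\le C$. Then $\overline{\mathcal S}_T(HC(T))$ is a dense $G_\delta$ subset of $\overline{\mathcal S}_T(X)$.
   Context: $X$ has type $p$ if there is $C'$ with $\mathbb E\|\sum_n\varepsilon_nx_n\|^p\le C'\sum_n\|x_n\|^p$ for all finite sequences $(x_n)$, $\varepsilon_n$ independent Rademacher variables. A family $(\lambda_k)_{k\in K}\subset\mathbb T$ is independent if $\prod_k\lambda_k^{m_k}=1$ with $m_k\in\mathbb Z$ forces all $m_k=0$. A Steinhaus measure for $T$ is the distribution of $\sum_{j\in J}\chi_jx_j$, $J$ finite, $x_j$ unimodular eigenvectors of $T$, $\chi_j$ independent and uniformly distributed on $\mathbb T$; $\overline{\mathcal S}_T(X)$ is the closure of the set of Steinhaus measures in the Prokhorov topology, and $\overline{\mathcal S}_T(A)=\{m\in\overline{\mathcal S}_T(X):m(A)=1\}$. $HC(T)$ is the set of vectors with dense orbit. *)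

(* Defs.v *)
From HB Require Import structures.
From mathcomp Require Import all_boot all_order all_algebra.
From mathcomp Require Import all_classical all_reals all_analysis.
From mathcomp Require Import complex.

Set Implicit Arguments.
Unset Strict Implicit.
Unset Printing Implicit Defensive.

Import Order.TTheory GRing.Theory Num.Theory.
Import numFieldNormedType.Exports.

Local Open Scope classical_set_scope.
Local Open Scope ring_scope.

Section Defs.
Variables (R : realType) (X : normedModType R[i]).

(* The (real) norm of a vector of the complex normed space X.  In
   mathcomp-analysis the norm of a normedModType K is K-valued; for K = R[i]
   it is a nonnegative real complex number, we take its real part. *)
Definition nrm (x : X) : R := complex.Re (`|x|).

Definition separable_space : Prop :=
  exists D : set X, countable D /\ dense D.

(* Type p (Rademacher type), with the expectation over independent Rademacher
   signs written out as the average over all sign choices eps : 'I_N -> bool. *)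
Definition has_type (p : R) : Prop :=
  exists C' : R, forall (N : nat) (x : 'I_N -> X),
    (2 ^+ N)^-1 * \sum_(eps : {ffun 'I_N -> bool})
        (nrm (\sum_(n < N) (if eps n then x n else - x n))) `^ p
      <= C' * \sum_(n < N) (nrm (x n)) `^ p.

Definition unimodular_eigen (T : X -> X) (u : X) (lam : R[i]) : Prop :=
  u <> 0 /\ `|lam| = 1 /\ T u = lam *: u.

Definition independent_family (n : nat) (lam : 'I_n -> R[i]) : Prop :=
  forall m : 'I_n -> int, \prod_(k < n) (lam k ^ m k) = 1 -> forall k, m k = 0.

Definition HC (T : X -> X) : set X :=
  [set x | dense (range (fun n : nat => iter n T x))].

Definition BX := g_sigma_algebraType (@open X).
Definition Pmeas := probability BX R.

(* chi(theta) = exp(2 i pi theta); theta uniform on [0,1] gives chi uniform on T *)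
Definition chi (t : R) : R[i] := (cos (2 * pi * t) +i* sin (2 * pi * t))%C.

(* Iterated integral over [0,1]^n (product of n Lebesgue measures on [0,1]):
   integrates g over the first n coordinates th 0, ..., th (n-1). *)
Fixpoint iter_int (n : nat) (g : (nat -> R) -> \bar R) : \bar R :=
  match n with
  | 0 => g (fun _ => 0)
  | n'.+1 => (\int[@lebesgue_measure R]_(t in `[0%R, 1%R])
                iter_int n' (fun th => g (fun k => if k == 0%N then t else th k.-1)))%E
  end.

(* Steinhaus measures for T: distributions of sum_j chi_j x_j, with x_j
   unimodular eigenvectors and chi_j i.i.d. uniform on the unit circle. *)
Definition steinhaus (T : X -> X) (m : Pmeas) : Prop :=
  exists (n : nat) (x : 'I_n -> X),
    (forall j, exists lam, unimodular_eigen T (x j) lam) /\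
    forall A : set BX, measurable A ->
      m A = iter_int n (fun th => (\1_A (\sum_(j < n) chi (th j) *: x j : BX))%:E).

(* Prokhorov metric: open e-enlargement and the "e-close" relation;
   d_P(m1, m2) < e iff m1, m2 are e'-close for some 0 < e' < e. *)
Definition enl (A : set X) (e : R) : set X :=
  [set x | exists2 y, A y & nrm (x - y) < e].

Definition pclose (m1 m2 : Pmeas) (e : R) : Prop :=
  forall A : set BX, measurable A ->
    (m1 A <= m2 (enl A e) + e%:E)%E /\ (m2 A <= m1 (enl A e) + e%:E)%E.

Definition pball (m : Pmeas) (e : R) : set Pmeas :=
  [set m' | exists2 e', 0 < e' < e & pclose m m' e'].

Definition popen (V : set Pmeas) : Prop :=
  forall m, V m -> exists2 e, 0 < e & pball m e `<=` V.

Definition pclosure (S : set Pmeas) : set Pmeas :=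
  [set m | forall e, 0 < e -> exists2 s, S s & pball m e s].

Definition Sbar (T : X -> X) : set Pmeas := pclosure (steinhaus T).

Definition SbarA (T : X -> X) (A : set X) : set Pmeas :=
  [set m | Sbar T m /\ m (A : set BX) = 1%E].

Definition pGdelta_in (Y A : set Pmeas) : Prop :=
  exists2 V : nat -> set Pmeas, (forall n, popen (V n)) & A = Y `&` \bigcap_n V n.

Definition pdense_in (Y A : set Pmeas) : Prop :=
  A `<=` Y /\ forall m, Y m -> forall e, 0 < e -> exists2 m', A m' & pball m e m'.

End Defs.

(* Main.v *)
Require Import Defs.
From HB Require Import structures.
From mathcomp Require Import all_boot all_order all_algebra.
From mathcomp Require Import all_classical all_reals all_analysis.
From mathcomp Require Import measurable_realfun complex.
From mathcomp Require Import ring lra zify.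

Set Implicit Arguments.
Unset Strict Implicit.
Unset Printing Implicit Defensive.

Import Order.TTheory GRing.Theory Num.Theory.
Import numFieldNormedType.Exports.

Local Open Scope classical_set_scope.
Local Open Scope ring_scope.

(** A vector with independent unimodular eigenvalues is moved by [T] over a
    dense part of the torus of its rotated versions (Kronecker). Hence, if
    [sum_k u_k] lies in an open set [Omega] with [T^-1 Omega] included in
    [Omega], so does [sum_k chi_k u_k] for every choice of unimodular [chi_k],
    and the hypothesis, applied to dilates of [Omega], produces Steinhaus
    measures carried by [Omega] which type [p] makes arbitrarily close to the
    Dirac mass at [0].

    To perturb a given Steinhaus measure with eigenvalues [lambda], the new
    eigenvalues must be independent modulo the group generated by [lambda]. By
    an exchange argument this costs at most as many vectors as there are
    [lambda]'s, and those vectors are small. Adding one small family per point of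
    a finite net of the torus yields a perturbation all of whose values visit a
    prescribed ball, with a uniform margin.

    Iterating, and visiting each ball of a countable basis infinitely often,
    gives random vectors [Z_n] on [0,1[ that converge almost surely; the law of
    the limit is a limit of Steinhaus measures and is carried by [HC T]. The
    independent angles are built from the binary digits of a uniform variable, and
    [Z_n] uses finitely many digits, so that all probabilities are counts.
    The [G_delta] property is the openness of [{m | m Omega > c}]. *)

(** * Kronecker's theorem *)

Section ComplexModulus.
Variable R : realType.
Local Notation C := R[i].

(** The norm of [R[i]] takes its values in [R[i]]; its real part is taken so that estimates live in
    the ordered field [R]. *)
Definition cabs (z : C) : R := complex.Re `|z|.

Lemma cabsE (z : C) : `|z| = (cabs z)%:C%C.
Proof. by rewrite /cabs normc_def. Qed.

Lemma cabs_ge0 z : 0 <= cabs z.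
Proof. by rewrite -lecR -cabsE normr_ge0. Qed.

Lemma cabsM z w : cabs (z * w) = cabs z * cabs w.
Proof. by apply: complexI; rewrite rmorphM /= -!cabsE normrM. Qed.

Lemma cabs_unimodular z : `|z| = 1 -> cabs z = 1.
Proof. by rewrite /cabs => ->. Qed.

Lemma cabsD z w : cabs (z + w) <= cabs z + cabs w.
Proof. by rewrite -lecR rmorphD /= -!cabsE ler_normD. Qed.

Lemma cabsN z : cabs (- z) = cabs z.
Proof. by rewrite /cabs normrN. Qed.

Lemma cabsC z w : cabs (z - w) = cabs (w - z).
Proof. by rewrite /cabs distrC. Qed.

Lemma normRe_le_cabs z : `|complex.Re z| <= cabs z.
Proof. by rewrite -lecR -cabsE normc_ge_Re. Qed.

Lemma cabs_eq0 z : cabs z = 0 -> z = 0.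
Proof. by move=> z0; apply/normr0_eq0; rewrite cabsE z0. Qed.

Lemma unimodular_neq0 (z : C) : `|z| = 1 -> z != 0.
Proof. by move=> z1; rewrite -normr_eq0 z1 oner_neq0. Qed.

Lemma norm_exprz_unimodular (z : C) (m : int) : `|z| = 1 -> `|z ^ m| = 1.
Proof.
by move=> z1; case: m => n; rewrite ?NegzE -?exprnN ?normfV -?exprnP normrX z1 expr1n ?invr1.
Qed.

Lemma Re_sum (I : Type) (r : seq I) (P : pred I) (F : I -> C) :
  complex.Re (\sum_(i <- r | P i) F i) = \sum_(i <- r | P i) complex.Re (F i).
Proof.
by elim/big_rec2: _ => // i x y _ <-; case: (F i) => a b; case: y.
Qed.

Lemma Re_realM (a : R) (z : C) : complex.Re (a%:C%C * z) = a * complex.Re z.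
Proof. by case: z => x y /=; rewrite mul0r subr0. Qed.

(* Bounded oscillation when [t != 1]; nonnegative when [t = 1]. *)
Lemma geometric_Re_lower_bound (a : R) (t g : C) : 0 <= a -> `|t| = 1 -> `|g| = 1 ->
  (t = 1 -> g = 1) ->
  exists K : R, forall N, - K <= complex.Re (a%:C%C * g^-1 * \sum_(n < N) t ^+ n).
Proof.
move=> a0 t1 g1 tg; have [tE|tn1] := eqVneq t 1.
  exists 0 => N; rewrite oppr0 tE tg// invr1 mulr1.
  under eq_bigr do rewrite expr1n.
  rewrite sumr_const card_ord -(rmorph_nat (real_complex R)) Re_realM /=.
  by rewrite mulr_ge0.
have t10 : 0 < cabs (t - 1).
  rewrite lt_neqAle cabs_ge0 andbT eq_sym; apply/eqP => /cabs_eq0/eqP.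
  by rewrite subr_eq0 (negbTE tn1).
(* The constant comes from the closed form of the geometric sum: multiplied by [t - 1] it is
   [t ^+ N - 1], of modulus at most 2. *)
exists (a * (2 / cabs (t - 1))) => N.
rewrite -mulrA Re_realM -mulrN ler_wpM2l//.
rewrite lerNl (le_trans (ler_norm _))// normrN.
 apply: (le_trans (normRe_le_cabs _)).
rewrite cabsM (@cabs_unimodular g^-1) ?normfV ?g1 ?invr1// mul1r.
rewrite ler_pdivlMr// mulrC -cabsM -subrX1 (le_trans (cabsD _ _))//.
by rewrite cabsN !cabs_unimodular ?normr1 ?normrX ?t1 ?expr1n.
Qed.

End ComplexModulus.

(** Bounds from below the constant Fourier coefficient of the kernel used for Kronecker's theorem:
    relative to [4 ^ p] it decays only like [1 / (2p + 1)]. *)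
Lemma central_bin_lower (p : nat) : (4 ^ p <= p.*2.+1 * 'C(p.*2, p))%N.
Proof.
elim: p => [//|p IH].
have e1 : (p.*2.+2 * 'C(p.*2.+1, p) = p.+1 * 'C(p.*2.+2, p.+1))%N.
  exact: (mul_bin_diag p.*2.+2 p).
have e2 : (p.*2.+1 * 'C(p.*2, p) = p.+1 * 'C(p.*2.+1, p))%N.
  by rewrite (mul_bin_down p.*2.+1 p); congr (_ * _)%N; lia.
rewrite doubleS expnS.
have : (4 * 4 ^ p <= 4 * (p.+1 * 'C(p.*2.+1, p)))%N by rewrite leq_mul2l -e2 IH.
move/leq_trans; apply.
have {}e1 : (2 * 'C(p.*2.+1, p) = 'C(p.*2.+2, p.+1))%N.
  apply/eqP; rewrite -(eqn_pmul2l (ltn0Sn p)) -e1; apply/eqP; lia.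
by rewrite -e1; nia.
Qed.

Section PolynomialDecay.
Variable R : realType.

(** Geometric decay beats polynomial growth: Bernoulli's inequality gives
    [y ^+ q <= 1 / (1 + q * eta)], and the exponent [p = D.+1 * q] supplies one more such factor
    than the [D] needed to absorb the polynomial. *)
Lemma exists_poly_decay (D : nat) (y : R) : 0 <= y < 1 ->
  exists p : nat, p.*2.+1%:R ^+ D * y ^+ p < 1.
Proof.
move=> /andP[y0 y1]; pose eta : R := 1 - y; have eta0 : 0 < eta by rewrite /eta; lra.
(* [K] is chosen so that [2p + 1 <= K * (1 + q * eta)] for [p = D.+1 * q], and [q] so that the
   remaining factor exceeds [K ^+ D]. *)
pose K := (D.+1.*2.+1)%:R / eta + 1 : R.
have K0 : 0 < K by rewrite /K addr_gt0// divr_gt0.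
pose q := (Num.truncn (K ^+ D / eta)).+1.
have hq : K ^+ D < 1 + q%:R * eta.
  have : K ^+ D / eta < q%:R by rewrite truncnS_gt.
  rewrite ltr_pdivrMr//; lra.
have yq : y ^+ q <= (1 + q%:R * eta)^-1.
  rewrite -[leRHS]mul1r ler_pdivlMr; last first.
    by rewrite ltr_pwDl// mulr_ge0 ?ltW.
  elim: q {hq} => [|q IH]; first by rewrite expr0 mul0r addr0 mulr1.
  rewrite exprS; apply: le_trans IH.
  rewrite mulrAC [leRHS]mulrC ler_wpM2r ?exprn_ge0//.
  rewrite -natr1; have -> : y = 1 - eta by rewrite /eta opprB addrC subrK.
  have := mulr_ge0 (ler0n R q) (sqr_ge0 eta); have := sqr_ge0 eta.
  by rewrite expr2; clearbody eta; move: (q%:R) => Q; lra.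
exists (D.+1 * q)%N; rewrite mulnC exprM.
have b0 : 0 < 1 + q%:R * eta by rewrite ltr_pwDl// mulr_ge0 ?ltW.
have : (y ^+ q) ^+ D.+1 <= ((1 + q%:R * eta)^-1) ^+ D.+1.
  by rewrite lerXn2r// nnegrE ?exprn_ge0// invr_ge0 ltW.
rewrite exprVn => h; apply: (le_lt_trans (ler_wpM2l _ h)); first exact: exprn_ge0.
rewrite ltr_pdivrMr ?exprn_gt0// mul1r exprS.
apply: (@le_lt_trans _ _ (K ^+ D * (1 + q%:R * eta) ^+ D)); last first.
  by rewrite ltr_pM2r ?exprn_gt0.
rewrite -exprMn lerXn2r ?nnegrE//; first by rewrite mulr_ge0 ?(ltW K0) ?(ltW b0).
have ke : (D.+1.*2.+1)%:R / eta * eta = (D.+1.*2)%:R + 1 :> R.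
  by rewrite mulfVK ?gt_eqF// natr1.
have k0 : 0 <= (D.+1.*2.+1)%:R / eta :> R by rewrite divr_ge0 ?ltW.
have e : ((q * D.+1).*2.+1)%:R = q%:R * (D.+1.*2)%:R + 1 :> R.
  by rewrite -natrM natr1 doubleMr.
have qe : 0 <= q%:R * eta by rewrite mulr_ge0 ?ltW.
have Q0 := ler0n R q; rewrite e /K; clearbody q eta.
move: (_ / eta) ke k0 => k ke k0.
have := congr1 (fun u => q%:R * u) ke; rewrite /= => ke'.
clear -ke' Q0 qe k0; move: (D.+1.*2%:R) (q%:R) ke' Q0 qe => dd Q ke' Q0 qe.
lra.
Qed.

End PolynomialDecay.

(** * Simultaneous approximation of unimodular numbers by powers *)

Section Kronecker.
Variables (R : realType) (D : nat) (theta c : 'I_D -> R[i]).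
Hypotheses (theta1 : forall i, `|theta i| = 1) (c1 : forall i, `|c i| = 1).
Hypothesis relations : forall m : 'I_D -> int,
  \prod_i theta i ^ m i = 1 -> \prod_i c i ^ m i = 1.

(** [z n i] is near [1] exactly when [theta i ^+ n] is near [c i]. On the unit circle [kap w] is
    [|1 + w|^2 / 4], a bump with maximum [1] attained only at [w = 1]. *)
Let z n i := theta i ^+ n * (c i)^-1.
Let kap (w : R[i]) : R := (1 + complex.Re w) / 2.

Let z1 n i : `|z n i| = 1.
Proof. by rewrite normrM normrX normfV theta1 c1 invr1 mulr1 expr1n. Qed.

Let kapE (w : R[i]) : `|w| = 1 -> (4 * kap w)%:C%C * w = (1 + w) ^+ 2.
Proof.
move=> w1; have w0 := unimodular_neq0 w1.
have wJ : w * w^*%C = 1 by rewrite -sqr_normc w1 expr1n.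
have -> : (4 * kap w)%:C%C = 2 + (w + w^*%C).
  rewrite /kap; case: (w) => a b; apply/eqP; rewrite eq_complex /=.
  by apply/andP; split; apply/eqP; field.
by rewrite !mulrDl [w^*%C * w]mulrC wJ; ring.
Qed.

(** On the circle [4 * kap w * w = (1 + w) ^+ 2], so this is the binomial expansion of
    [(1 + w) ^+ (2p)] divided by [w ^+ p]. *)
Let kernel_expand (p : nat) (w : R[i]) : `|w| = 1 ->
  ((4 * kap w) ^+ p)%:C%C =
  \sum_(m < p.*2.+1) ('C(p.*2, m)%:R : R)%:C%C * w ^ (m%:Z - p%:Z).
Proof.
move=> w1; have w0 := unimodular_neq0 w1.
apply: (mulIf (expf_neq0 p w0)); rewrite rmorphXn /= -exprMn kapE//.
rewrite -exprM mul2n exprDn mulr_suml; apply: eq_bigr => m _.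
rewrite expr1n mul1r rmorph_nat -mulrA -[w ^+ p]/(w ^ p%:Z) -expfzDr//.
by rewrite subrK mulr_natl.
Qed.

Let kap_bnd w : `|w| = 1 -> 0 <= kap w <= 1.
Proof.
by move=> w1; have := normRe_le_cabs w; rewrite cabs_unimodular// /kap ler_norml; lra.
Qed.

(* The Fourier coefficients of the kernel [((1 + Re z) / 2) ^+ p] are nonnegative
   and, by [relations], every resonant character takes the value [1] at [c]; the
   other characters average out, so the mean is at least the constant coefficient,
   which decays only polynomially in [p]. *)
Lemma kernel_average_lower (p : nat) : exists K : R, forall N : nat,
  N%:R * 'C(p.*2, p)%:R ^+ D - K <= \sum_(n < N) \prod_i (4 * kap (z n i)) ^+ p.
Proof.
pose F := {ffun 'I_D -> 'I_p.*2.+1}.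
pose e (f : F) i := (f i)%:Z - p%:Z.
pose a (f : F) : R := \prod_i 'C(p.*2, f i)%:R.
pose t (f : F) := \prod_i theta i ^ e f i.
pose g (f : F) := \prod_i c i ^ e f i.
have a0 f : 0 <= a f by apply: prodr_ge0.
have t1 f : `|t f| = 1.
  by rewrite normr_prod big1// => i _; rewrite norm_exprz_unimodular.
have g1 f : `|g f| = 1.
  by rewrite normr_prod big1// => i _; rewrite norm_exprz_unimodular.
have expand N : \sum_(n < N) \prod_i (4 * kap (z n i)) ^+ p =
    \sum_f complex.Re ((a f)%:C%C * (g f)^-1 * \sum_(n < N) t f ^+ n).
  rewrite -Re_sum.
  transitivity (complex.Re (\sum_(n < N) \prod_i ((4 * kap (z n i)) ^+ p)%:C%C)).
    by rewrite Re_sum; apply: eq_bigr => n _; rewrite -rmorph_prod.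
  congr complex.Re.
  under [RHS]eq_bigr do rewrite mulr_sumr.
  rewrite exchange_big /=; apply: eq_bigr => n _.
  under eq_bigr do rewrite kernel_expand//.
  rewrite (bigA_distr_bigA (fun i (m : 'I_p.*2.+1) =>
    ('C(p.*2, m)%:R : R)%:C%C * z n i ^ (m%:Z - p%:Z))) /=.
  apply: eq_bigr => f _; rewrite big_split /= -rmorph_prod /= -mulrA; congr (_ * _).
  rewrite /g /t -prodrXl -prodfV -big_split /=; apply: eq_bigr => i _.
  have th0 := unimodular_neq0 (theta1 i); have c0 := unimodular_neq0 (c1 i).
  rewrite /z exprzMl ?unitfE ?invr_eq0 ?expf_neq0// exprz_inv invr_expz mulrC.
  by congr (_ * _); rewrite !exprnP !exprz_exp mulrC.
have hK f : exists K : R, forall N, - K <=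
    complex.Re ((a f)%:C%C * (g f)^-1 * \sum_(n < N) t f ^+ n).
  by apply: geometric_Re_lower_bound => //; apply: relations.
have [K hK'] := choice hK.
(* [f0] is the frequency with all exponents zero. Its term gives the main part, linear in [N]; each
   other term is bounded below independently of [N]. *)
pose f0 : F := [ffun=> inord p].
exists (\sum_(f | f != f0) K f) => N.
have vf0 i : f0 i = p :> nat by rewrite ffunE inordK// ltnS -addnn leq_addr.
rewrite expand [leRHS](bigD1 f0)//=; apply: lerD; last first.
  by rewrite -sumrN; apply: ler_sum => f _; exact: hK'.
have -> : t f0 = 1 by rewrite /t big1// => i _; rewrite /e vf0 subrr expr0z.
have -> : g f0 = 1 by rewrite /g big1// => i _; rewrite /e vf0 subrr expr0z.
have -> : a f0 = 'C(p.*2, p)%:R ^+ D.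
  by rewrite /a (eq_bigr (fun=> 'C(p.*2, p)%:R)) => [|i _]; rewrite ?vf0// prodr_const card_ord.
under eq_bigr do rewrite expr1n.
rewrite invr1 mulr1 sumr_const card_ord -(rmorph_nat (real_complex R)) Re_realM /=.
by rewrite mulrC.
Qed.

(** If at each time [n] some coordinate stayed [e] away, each product of kernels would lose a factor
    [y ^+ p] with [y < 1]. For [p] large this contradicts the lower bound on the average, whose loss
    is only polynomial in [p]. *)
Theorem kronecker (e : R) : 0 < e -> exists n : nat, forall i, cabs (theta i ^+ n - c i) < e.
Proof.
move=> e0; apply: contrapT => /forallNP noN.
(* For [w] on the circle [|w - 1|^2 = 2 - 2 Re w], so a distance at least [e] from [1] forces
   [kap w <= 1 - e^2 / 4]. The maximum with [0] keeps [y] in [[0, 1[] for large [e]. *)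
pose y := Num.max 0 (1 - e ^+ 2 / 4).
have y01 : 0 <= y < 1.
  rewrite le_max lexx /= gt_max ltr01 /= ltrBlDr ltrDl divr_gt0 ?exprn_gt0//.
have close n : exists2 i, e <= cabs (theta i ^+ n - c i) & kap (z n i) <= y.
  have /existsNP[i /negP] := noN n; rewrite -leNgt => hi; exists i => //.
  have : e ^+ 2 <= cabs (z n i - 1) ^+ 2.
    have c0 := unimodular_neq0 (c1 i); move: hi.
    have -> : theta i ^+ n - c i = (z n i - 1) * c i by rewrite /z mulrBl mul1r mulfVK.
    rewrite cabsM (cabs_unimodular (c1 i)) mulr1 => hi.
    by rewrite lerXn2r// nnegrE ?cabs_ge0// ltW.
  have -> : cabs (z n i - 1) ^+ 2 = 2 - 2 * complex.Re (z n i).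
    apply: complexI; rewrite rmorphXn /= -cabsE sqr_normc.
    have : z n i * (z n i)^*%C = 1 by rewrite -sqr_normc z1 expr1n.
    case: (z n i) => u v /eqP; rewrite !eq_complex /= => /andP[/eqP h _].
    apply/eqP; rewrite eq_complex /=; apply/andP; split; apply/eqP; last by ring.
    transitivity (u * u - v * - v + 1 - 2 * u); first by ring.
    by rewrite h; ring.
  by rewrite le_max /kap => ?; apply/orP; right; lra.
have [p hp] := @exists_poly_decay R D y y01.
have [K hK] := kernel_average_lower p.
have upper n : \prod_i (4 * kap (z n i)) ^+ p <= (4 ^+ p) ^+ D * y ^+ p.
  have [i _ hi] := close n.
  under eq_bigr do rewrite exprMn.
  rewrite big_split /= prodr_const card_ord ler_wpM2l ?exprn_ge0//.
  rewrite (bigD1 i)//= -[leRHS]mulr1.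
  have kz j := kap_bnd (z1 n j).
  apply: ler_pM; first by rewrite exprn_ge0; have /andP[] := kz i.
  - by apply: prodr_ge0 => j _; rewrite exprn_ge0; have /andP[] := kz j.
  - by rewrite lerXn2r ?nnegrE//; [have /andP[] := kz i|case/andP: y01].
  - by apply: prodr_ile1 => j _; have /andP[k0 k1] := kz j; rewrite exprn_ge0 ?exprn_ile1.
have cb : (4 ^+ p : R) <= p.*2.+1%:R * 'C(p.*2, p)%:R.
  by rewrite -natrX -natrM ler_nat central_bin_lower.
have strict : (4 ^+ p) ^+ D * y ^+ p < 'C(p.*2, p)%:R ^+ D.
  apply: (@le_lt_trans _ _ ((p.*2.+1%:R * 'C(p.*2, p)%:R) ^+ D * y ^+ p)).
    rewrite ler_wpM2r ?exprn_ge0 ?lerXn2r ?nnegrE ?exprn_ge0//; first by case/andP: y01.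
  rewrite exprMn mulrAC -[ltRHS]mul1r ltr_pM2r// exprn_gt0// ltr0n bin_gt0.
  by rewrite -addnn leq_addr.
set A := (4 ^+ p) ^+ D * y ^+ p in upper strict; set B := 'C(p.*2, p)%:R ^+ D in hK strict.
have main N : N%:R * (B - A) <= K.
  have := hK N.
  have : \sum_(n < N) \prod_i (4 * kap (z n i)) ^+ p <= \sum_(n < N) A by apply: ler_sum.
  rewrite sumr_const card_ord -[A *+ N]mulr_natl; lra.
have BA : 0 < B - A by lra.
have := main (Num.truncn (K / (B - A))).+1; rewrite leNgt => /negP; apply.
by rewrite -ltr_pdivrMr// truncnS_gt.
Qed.

End Kronecker.

(** * Multiplicative independence over a finitely generated group *)

Section MultiplicativeIndependence.
Variable R : realType.
Local Notation C := R[i].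

(** The multiplicative group generated by [s], in a recursive form that splits off the power of one
    generator at a time. *)
Fixpoint gen (s : seq C) : set C :=
  if s is l :: s' then [set z | exists h, gen s' h /\ exists c : int, z = h * l ^ c]
  else [set 1].

Definition unimod (s : seq C) := all (fun z => `|z| == 1) s.

Lemma unimod_nth (s : seq C) i : unimod s -> (i < size s)%N -> `|s`_i| = 1.
Proof. by move=> /all_nthP h /h => /(_ 0)/eqP. Qed.

Lemma unimod_cat (s t : seq C) : unimod (s ++ t) = unimod s && unimod t.
Proof. exact: all_cat. Qed.

Lemma gen1 s : gen s 1.
Proof. by elim: s => //= l s IH; exists 1; split => //; exists 0; rewrite expr0z mulr1. Qed.

Lemma genM s x y : unimod s -> gen s x -> gen s y -> gen s (x * y).
Proof.
elim: s x y => /= [x y _ -> ->|l s IH x y /andP[/eqP l1 us]]; first by rewrite mulr1.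
move=> [h [hs [c ->]]] [h' [hs' [c' ->]]].
exists (h * h'); split; first exact: IH.
by exists (c + c'); rewrite expfzDr ?unimodular_neq0// mulrACA.
Qed.

Lemma gen_unit s x : unimod s -> gen s x -> x \is a GRing.unit.
Proof.
rewrite unitfE; elim: s x => /= [x _ ->|l s IH x /andP[/eqP l1 us] [h [hs [c ->]]]].
  exact: oner_neq0.
by apply: mulf_neq0; [exact: IH|rewrite expfz_neq0 ?unimodular_neq0].
Qed.

Lemma genXz s x (c : int) : unimod s -> gen s x -> gen s (x ^ c).
Proof.
elim: s x => /= [x _ ->|l s IH x /andP[/eqP l1 us]]; first by rewrite exp1rz.
move=> [h [hs [c' ->]]]; exists (h ^ c); split; first exact: IH.
have h0 := gen_unit us hs.
exists (c' * c); rewrite exprzMl ?exprz_exp// unitfE expfz_neq0 ?unimodular_neq0//.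
Qed.

Lemma genV s x : unimod s -> gen s x -> gen s x^-1.
Proof. by move=> us gx; rewrite -[x^-1]/(x ^ (-1)); exact: genXz. Qed.

Lemma gen_catr s v x : gen s x -> gen (v ++ s) x.
Proof.
by elim: v => //= l v IH /IH hx; exists x; split => //; exists 0; rewrite expr0z mulr1.
Qed.

Lemma gen_prod (w v : seq C) (m : nat -> int) : unimod w -> unimod v ->
  gen (v ++ w) (\prod_(i < size v) v`_i ^ m i).
Proof.
elim: v m => [|l v IH] m uw //=; first by rewrite big_ord0 => _; exact: gen1.
move=> /andP[_ uv]; rewrite big_ord_recl /= mulrC; eexists; split; last by exists (m 0%N).
exact: (IH (fun i => m i.+1)).
Qed.

(** Independence modulo the group generated by [w], in triangular form: an entry is tested only
    against [w] and the entries after it, so families can be enlarged one by one. *)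
Fixpoint indep_over (w v : seq C) : Prop :=
  if v is l :: v' then
    indep_over w v' /\ forall c : int, gen (v' ++ w) (l ^ c) -> c = 0
  else True.

Lemma indep_over_cat (w v1 v2 : seq C) :
  indep_over w v1 -> indep_over (v1 ++ w) v2 -> indep_over w (v2 ++ v1).
Proof.
move=> i1; elim: v2 => //= l v2 IH [/IH i2 h]; split=> // c.
by rewrite -catA; exact: h.
Qed.

(** Dividing a relation by the product over the tail puts a power of the head into [gen (v ++ w)],
    so its exponent vanishes; the tail follows by induction. *)
Lemma indep_over_exponents (w v : seq C) (m : nat -> int) :
  unimod w -> unimod v -> indep_over w v ->
  gen w (\prod_(i < size v) v`_i ^ m i) -> forall i, (i < size v)%N -> m i = 0.
Proof.
elim: v m => //= l v IH m uw /andP[l1 uv] [iv il].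
rewrite big_ord_recl /= => g.
set Q := \prod_(i < size v) _ in g.
have gQ : gen (v ++ w) Q by exact: (gen_prod (fun i => m i.+1)).
have uvw : unimod (v ++ w) by rewrite unimod_cat uv.
have Q0 : Q != 0.
  apply/prodf_neq0 => i _; rewrite expfz_neq0// unimodular_neq0//.
  by apply: unimod_nth => //; rewrite add0n.
have m0 : m 0%N = 0.
  apply: il; rewrite -[X in gen _ X](mulfK Q0); apply: genM => //.
    exact: gen_catr.
  exact: genV.
case=> [//|i]; rewrite ltnS => iv'; apply: (IH (fun i => m i.+1)) => //.
by move: g; rewrite m0 expr0z mul1r.
Qed.

(** Kronecker's theorem for [w ++ v] with target [1] on [w]. A relation has zero exponents on [v],
    by independence over [w], so the targets satisfy it whatever [c] is. *)
Theorem kronecker_over (w v : seq C) (c : nat -> C) (e : R) :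
  unimod w -> unimod v -> indep_over w v -> (forall i, `|c i| = 1) -> 0 < e ->
  exists n : nat,
    (forall i, (i < size w)%N -> cabs (w`_i ^+ n - 1) < e) /\
    (forall i, (i < size v)%N -> cabs (v`_i ^+ n - c i) < e).
Proof.
move=> uw uv iv c1 e0; pose D := (size w + size v)%N.
pose theta (i : 'I_D) := (w ++ v)`_i.
pose d (i : 'I_D) := if (i < size w)%N then 1 else c (i - size w)%N.
have uwv : unimod (w ++ v) by rewrite unimod_cat uw.
have [||m|n hn] := @kronecker R D theta d _ _ _ e e0.
- by move=> i; apply: unimod_nth; rewrite ?size_cat.
- by move=> i; rewrite /d; case: ifP; rewrite ?normr1.
- rewrite /D !big_split_ord /=.
  pose m1 i := if insub i is Some j then m (lshift (size v) j) else 0.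
  pose m2 i := if insub i is Some j then m (rshift (size w) j) else 0.
  have e1 : \prod_(i < size w) theta (lshift (size v) i) ^ m (lshift (size v) i) =
            \prod_(i < size w) w`_i ^ m1 i.
    by apply: eq_bigr => i _; rewrite /theta nth_cat /= ltn_ord /m1 valK.
  have e2 : \prod_(i < size v) theta (rshift (size w) i) ^ m (rshift (size w) i) =
            \prod_(i < size v) v`_i ^ m2 i.
    by apply: eq_bigr => i _; rewrite /theta nth_cat /= ltnNge leq_addr addKn /m2 valK.
  rewrite e1 e2 => rel.
  have g1 : gen w (\prod_(i < size w) w`_i ^ m1 i).
    by have := @gen_prod [::] w m1 isT uw; rewrite cats0.
  have m20 : forall i, (i < size v)%N -> m2 i = 0.
    apply: (indep_over_exponents uw uv iv).
    have -> : \prod_(i < size v) v`_i ^ m2 i = (\prod_(i < size w) w`_i ^ m1 i)^-1.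
      by apply/esym/divr1_eq; rewrite -invfM rel invr1.
    exact: genV.
  rewrite [X in X * _]big1 ?mul1r ?big1// => i _; last first.
    by rewrite /d /= ltn_ord exp1rz.
  have := m20 i (ltn_ord i); rewrite /m2 valK => ->.
  by rewrite expr0z.
exists n; split=> i ib.
  have iD : (i < D)%N by rewrite ltn_addr.
  by have := hn (Ordinal iD); rewrite /theta /d /= nth_cat ib.
have iD : (size w + i < D)%N by rewrite ltn_add2l.
by have := hn (Ordinal iD); rewrite /theta /d /= nth_cat ltnNge leq_addr /= addKn.
Qed.

(** * Trading eigenvalues to keep independence *)

Section Exchange.
Variables (n : nat) (mu : 'I_n -> C).
Hypothesis mu1 : forall k, `|mu k| = 1.

Let indepS (H : set C) (s : seq 'I_n) :=
  forall b : 'I_n -> int, H (\prod_(k <- s) mu k ^ b k) -> {in s, forall k, b k = 0}.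

Let mu0 k : mu k != 0.
Proof. exact: unimodular_neq0. Qed.

Let prodXz (s : seq 'I_n) (b b' : 'I_n -> int) (c c' : int) :
  \prod_(k <- s) mu k ^ (c * b k + c' * b' k) =
  (\prod_(k <- s) mu k ^ b k) ^ c * (\prod_(k <- s) mu k ^ b' k) ^ c'.
Proof.
elim: s => [|k s IH]; first by rewrite !big_nil !exp1rz mulr1.
have P0 (b'' : 'I_n -> int) : \prod_(k <- s) mu k ^ b'' k \is a GRing.unit.
  by rewrite unitfE prodf_seq_neq0; apply/allP => j _; rewrite expfz_neq0.
rewrite !big_cons IH !exprzMl ?unitfE ?expfz_neq0// -?unitfE// mulrACA.
by congr (_ * _); rewrite expfzDr// !exprz_exp ![_ * c]mulrC ![_ * c']mulrC.
Qed.

(* Each new generator costs at most one index: if it creates a relation, any index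
   occurring in that relation can be traded for it. *)
Lemma exchange (w : seq C) : unimod w -> independent_family mu ->
  exists s : seq 'I_n, [/\ uniq s, (n <= size s + size w)%N & indepS (gen w) s].
Proof.
move=> + imu; elim: w => [_|l w IH /= /andP[/eqP l1 uw]].
  exists (index_enum 'I_n); split.
  - exact: index_enum_uniq.
  - by rewrite addn0 /index_enum -enumT size_enum_ord.
  - by move=> b /= /imu + k _; exact.
have [s [us ss iS]] := IH uw.
have [iS'|] := pselect (indepS (gen (l :: w)) s).
  by exists s; split=> //; rewrite (leq_trans ss)// addnS leqnSn.
move=> /existsNP[b /not_implyP[[h [hw [c hb]]] /existsNP[k0 /not_implyP[k0s bk0]]]].
have l0 := unimodular_neq0 l1.
have c0 : c <> 0.
  move=> c0; apply: bk0; apply: (iS b) => //.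
  by rewrite hb c0 expr0z mulr1.
exists (rem k0 s); split; first exact: rem_uniq.
  by rewrite size_rem// addnS -addSn prednK//; case: (s) k0s.
move=> b' [h' [hw' [c' hb']]] k.
rewrite mem_rem_uniq// !inE => /andP[kk0 ks].
pose b2 j := if j == k0 then 0 else b' j.
have hb2 : \prod_(j <- s) mu j ^ b2 j = h' * l ^ c'.
  rewrite (big_rem k0)//= {1}/b2 eqxx expr0z mul1r -hb'.
  apply: eq_big_seq => j; rewrite mem_rem_uniq// !inE => /andP[jk0 _].
  by rewrite /b2 (negbTE jk0).
(* The combination with weights [c] and [- c'] cancels the powers of [l], leaving a relation over
   [gen w] alone, to which [iS] applies. At [k0], where [b2] vanishes and [b] does not, it yields
   [c' = 0]. *)
have key : {in s, forall j, c * b2 j + - c' * b j = 0}.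
  have ul d : l ^ d \is a GRing.unit by rewrite unitfE expfz_neq0.
  apply: (iS (fun j => c * b2 j + - c' * b j)); rewrite prodXz hb hb2.
  rewrite !exprzMl ?(gen_unit uw hw) ?(gen_unit uw hw') ?ul//.
  rewrite !exprz_exp mulrACA -expfzDr// mulrN [c * c']mulrC subrr expr0z mulr1.
  by apply: genM => //; exact: genXz.
have c'0 : c' = 0.
  have := key k0 k0s; rewrite /b2 eqxx mulr0 add0r => /eqP.
  by rewrite mulf_eq0 oppr_eq0 => /orP[/eqP//|/eqP].
have := key k ks; rewrite /b2 (negbTE kk0) c'0 oppr0 mul0r addr0 => /eqP.
by rewrite mulf_eq0 => /orP[/eqP|/eqP].
Qed.

Lemma gen_map_cat (w : seq C) (s : seq 'I_n) z : uniq s -> gen (map mu s ++ w) z ->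
  exists h, gen w h /\ exists b : 'I_n -> int, z = h * \prod_(k <- s) mu k ^ b k.
Proof.
elim: s z => [z _ gz|k s IH z /= /andP[ks us] [h [/(IH _ us)[h' [gh' [b ->]]] [c ->]]]].
  by exists z; split=> //; exists (fun=> 0); rewrite big_nil mulr1.
exists h'; split => //; exists (fun j => if j == k then c else b j).
rewrite big_cons eqxx mulrAC -!mulrA; congr (_ * (_ * _)).
by apply: eq_big_seq => j js; case: eqP js ks => // -> ->.
Qed.

Lemma indepS_indep_over (w : seq C) (s : seq 'I_n) : unimod w ->
  uniq s -> indepS (gen w) s -> indep_over w (map mu s).
Proof.
move=> uw; elim: s => //= k s IH /andP[ks us] iS; split.
  apply: IH => // b gb j js.
  have := iS (fun i => if i == k then 0 else b i).
  rewrite big_cons eqxx expr0z mul1r.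
  rewrite (eq_big_seq (fun i => mu i ^ b i)); last first.
    by move=> i si; case: eqP si ks => // -> ->.
  move=> /(_ gb j); rewrite inE js orbT => /(_ isT).
  by case: eqP js ks => // -> ->.
move=> c /(gen_map_cat us)[h [gh [b hc]]].
have := iS (fun i => if i == k then c else - b i).
rewrite big_cons eqxx.
rewrite (eq_big_seq (fun i => mu i ^ (0 * b i + (- 1) * b i))); last first.
  by move=> i si; rewrite mul0r add0r mulN1r; case: eqP si ks => // -> ->.
rewrite prodXz expr0z mul1r hc -mulrA -[_ ^ (-1)]/(_^-1) divff; last first.
  by rewrite prodf_seq_neq0; apply/allP => j _; rewrite expfz_neq0.
by rewrite mulr1 => /(_ gh k); rewrite inE eqxx => /(_ isT).
Qed.

Lemma exchange_indep_over (w : seq C) : unimod w -> independent_family mu ->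
  exists s : seq 'I_n,
    [/\ uniq s, (n <= size s + size w)%N & indep_over w (map mu s)].
Proof.
move=> uw /(exchange uw)[s [us ss /(indepS_indep_over uw us)]].
by exists s; split.
Qed.

End Exchange.
End MultiplicativeIndependence.

(** * Norms and angles *)

Section RealNorm.
Variables (R : realType) (X : normedModType R[i]).
Local Notation C := R[i].
Implicit Types (x y : X) (c : C) (e r : R).

Lemma nrmE x : `|x| = (nrm x)%:C%C.
Proof.
by rewrite /nrm; have := normr_ge0 x; case: `|x| => a b; rewrite lecE /= => /andP[/eqP-> _].
Qed.

Lemma nrm_ge0 x : 0 <= nrm x.
Proof. by rewrite -lecR -nrmE normr_ge0. Qed.

Lemma nrmD x y : nrm (x + y) <= nrm x + nrm y.
Proof. by rewrite -lecR rmorphD /= -!nrmE ler_normD. Qed.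

Lemma nrmN x : nrm (- x) = nrm x.
Proof. by rewrite /nrm normrN. Qed.

Lemma nrm_sub x y : nrm (x - y) = nrm (y - x).
Proof. by rewrite /nrm distrC. Qed.

Lemma nrm0 : nrm (0 : X) = 0.
Proof. by rewrite /nrm normr0. Qed.

Lemma nrmZ c x : nrm (c *: x) = cabs c * nrm x.
Proof. by apply: complexI; rewrite rmorphM /= -cabsE -!nrmE normrZ. Qed.

Lemma nrmZ_real e x : 0 <= e -> nrm (e%:C%C *: x) = e * nrm x.
Proof.
move=> e0; rewrite nrmZ; congr (_ * _); apply: complexI.
by rewrite -cabsE ger0_norm// lecR.
Qed.

Lemma nrm_tri x y z : nrm (x - z) <= nrm (x - y) + nrm (y - z).
Proof. by rewrite (le_trans _ (nrmD _ _))// addrA subrK. Qed.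

Lemma nrm_sum (I : Type) (s : seq I) (P : pred I) (F : I -> X) :
  nrm (\sum_(i <- s | P i) F i) <= \sum_(i <- s | P i) nrm (F i).
Proof.
elim/big_rec2: _ => [|i a b _ h]; first by rewrite nrm0.
by rewrite (le_trans (nrmD _ _))// lerD2l.
Qed.

(** Balls of [X] have radii in [R[i]]; a positive element of [R[i]] is real, so neighbourhoods can
    be described by [nrm] and real radii. *)
Lemma nbhs_nrmP x (A : set X) :
  nbhs x A <-> exists2 e, 0 < e & forall y, nrm (x - y) < e -> A y.
Proof.
split=> [/nbhs_ballP[e /= e0 eA]|[e e0 eA]].
  have eE : e = (complex.Re e)%:C%C.
    by move: e0; case: (e) => a b; rewrite ltcE /= => /andP[/eqP-> _].
  exists (complex.Re e); first by rewrite -ltcR -eE.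
  move=> y xy; apply: eA; rewrite -ball_normE /ball_ /= nrmE eE.
  by rewrite ltcR.
apply/nbhs_ballP; exists e%:C%C; first by rewrite /= ltcR.
by move=> y; rewrite -ball_normE /ball_ /= nrmE ltcR => /eA.
Qed.

Lemma open_nrmP (A : set X) :
  open A <-> forall x, A x -> exists2 e, 0 < e & forall y, nrm (x - y) < e -> A y.
Proof.
rewrite openE; split=> [h x /h /nbhs_nrmP//|h x /h hx]; exact/nbhs_nrmP.
Qed.

Lemma continuous_at0_nrm (T : {linear X -> X}) : continuous T ->
  forall n e, 0 < e -> exists2 d, 0 < d & forall z, nrm z < d -> nrm (iter n T z) < e.
Proof.
move=> cT; elim=> [|n IH] e e0; first by exists e.
have /nbhs_nrmP[d d0 dT] : nbhs (0 : X) [set z | nrm (T z) < e].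
  apply: (cT 0 [set y | nrm y < e]); rewrite linear0; apply/nbhs_nrmP.
  by exists e => // y; rewrite sub0r nrmN.
have [d' d'0 hd'] := IH d d0; exists d' => // z /hd' h.
by apply: dT; rewrite sub0r nrmN.
Qed.

Lemma iter_linD (T : {linear X -> X}) n x y : iter n T (x + y) = iter n T x + iter n T y.
Proof. by elim: n => //= n ->; rewrite linearD. Qed.

Lemma iter_linN (T : {linear X -> X}) n x : iter n T (- x) = - iter n T x.
Proof. by elim: n => //= n ->; rewrite linearN. Qed.

Lemma iter_linZ (T : {linear X -> X}) n c x : iter n T (c *: x) = c *: iter n T x.
Proof. by elim: n => //= n ->; rewrite linearZ. Qed.

Lemma iter_linsum (T : {linear X -> X}) n (I : Type) (s : seq I) (F : I -> X) :
  iter n T (\sum_(i <- s) F i) = \sum_(i <- s) iter n T (F i).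
Proof.
elim: s => [|i s IH]; last by rewrite !big_cons iter_linD IH.
by rewrite !big_nil; elim: n => //= n ->; rewrite linear0.
Qed.

End RealNorm.

(** * The circle parametrised by an angle *)

Section Angle.
Variable R : realType.

Lemma cabs_chi (t : R) : cabs (chi t) = 1.
Proof. by rewrite /cabs normc_def /= cos2Dsin2 sqrtr1. Qed.

Lemma norm_chi (t : R) : `|chi t| = 1.
Proof. by rewrite cabsE cabs_chi. Qed.

Lemma chiD (s t : R) : chi (s + t) = chi s * chi t.
Proof.
rewrite /chi mulrDr cosD sinD; apply/eqP; rewrite eq_complex /=.
by apply/andP; split; apply/eqP; ring.
Qed.

Lemma chi_half : chi (2^-1 : R) = -1.
Proof.
rewrite /chi [2 * pi]mulrC -mulrA divff ?pnatr_eq0// mulr1 cospi sinpi.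
by apply/eqP; rewrite eq_complex /= oppr0 !eqxx.
Qed.

Lemma cabs_le_ReIm (z : R[i]) : cabs z <= `|complex.Re z| + `|complex.Im z|.
Proof.
case: z => a b; rewrite /cabs normc_def /=.
rewrite -[leRHS]ger0_norm ?addr_ge0// -sqrtr_sqr ler_sqrt ?sqr_ge0//.
rewrite sqrrD !real_normK ?num_real//.
by rewrite addrAC lerDl mulrn_wge0 ?mulr_ge0.
Qed.

(** As [chi] is a character, [chi s - chi t] is a unimodular multiple of [chi (s - t) - 1]:
    continuity at [0] is uniform continuity. *)
Lemma chi_unif (e : R) : 0 < e ->
  exists2 d : R, 0 < d & forall s t, `|s - t| < d -> cabs (chi s - chi t) <= e.
Proof.
move=> e0; have e2 : 0 < e / 2 by rewrite divr_gt0.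
have cc : {for 0, continuous (fun u : R => cos (2 * pi * u))}.
  apply: continuous_comp; last exact: continuous_cos.
  exact: mulrl_continuous.
have cs : {for 0, continuous (fun u : R => sin (2 * pi * u))}.
  apply: continuous_comp; last exact: continuous_sin.
  exact: mulrl_continuous.
have /cvgrPdist_lt/(_ _ e2)/nbhs_ballP[d1 /= d10 h1] := cc.
have /cvgrPdist_lt/(_ _ e2)/nbhs_ballP[d2 /= d20 h2] := cs.
exists (Num.min d1 d2); first by rewrite lt_min d10.
move=> s t; rewrite lt_min => /andP[st1 st2].
have -> : chi s - chi t = chi t * (chi (s - t) - 1).
  by rewrite mulrBr mulr1 -chiD [t + _]addrC subrK.
rewrite cabsM cabs_chi mul1r (le_trans (cabs_le_ReIm _))//.
have := h1 (s - t); rewrite -ball_normE /= sub0r normrN => /(_ st1).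
have := h2 (s - t); rewrite -ball_normE /= sub0r normrN => /(_ st2).
rewrite !mulr0 cos0 sin0 !sub0r normrN oppr0 addr0 distrC.
lra.
Qed.

Definition in01 (t : nat -> R) := forall j, 0 <= t j < 1.

(** Compactness of the torus in finite form: each angle is rounded down to a multiple of [1 / N].
    Angles below [1] keep the index of the multiple below [N]. *)
Lemma finite_angle_net (J : nat) (e : R) : 0 < e ->
  exists (F : finType) (g : F -> nat -> R), (forall f, in01 (g f)) /\
    forall t, in01 t -> exists f, forall j, (j < J)%N -> cabs (chi (t j) - chi (g f j)) <= e.
Proof.
move=> e0; have [d d0 hd] := chi_unif e0.
pose N := (Num.truncn d^-1).+1.
have Nd : N%:R^-1 < d by rewrite invf_plt ?posrE// truncnS_gt.
have N0 : 0 < N%:R :> R by [].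
elim: J => [|J [F [g [g01 hg]]]].
  exists unit, (fun _ _ => 0); split; first by move=> _ j; rewrite lexx ltr01.
  by move=> t _; exists tt.
exists (F * 'I_N)%type, (fun (f : F * 'I_N) j => if j == J then (f.2 : nat)%:R / N%:R else g f.1 j); split.
  move=> [f a] j /=; case: eqP => _; last exact: g01.
  by rewrite divr_ge0//= ltr_pdivrMr// mul1r ltr_nat.
move=> t t01; have [f hf] := hg t t01; have /andP[tJ0 tJ1] := t01 J.
have aN : (Num.truncn (t J * N%:R) < N)%N.
  by rewrite truncn_lt_nat ?mulr_ge0// gtr_pMl.
exists (f, Ordinal aN) => j /=; rewrite ltnS leq_eqVlt.
case: eqP => [-> _|_ /= /hf//]; apply: hd; apply: le_lt_trans Nd.
have Nn0 : N%:R != 0 :> R by rewrite gt_eqF.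
have -> : t J - (Ordinal aN : nat)%:R / N%:R = (t J * N%:R - (Ordinal aN : nat)%:R) / N%:R.
  by rewrite mulrBl mulfK.
rewrite normrM [X in _ * X]ger0_norm ?invr_ge0// -[leRHS]mul1r ler_wpM2r ?invr_ge0//=.
have /andP[h1 h2] := truncn_itv (mulr_ge0 tJ0 (ltW N0)).
by rewrite ler_norml; move: h2; rewrite -natr1; lra.
Qed.

End Angle.

(** * Families of unimodular eigenvectors *)

Section Families.
Variables (R : realType) (X : normedModType R[i]) (T : {linear X -> X}) (p : R).
Local Notation C := R[i].
Implicit Types (w v : seq (X * C)) (c d : nat -> C).

Definition eigfam w := {in w, forall q, unimodular_eigen T q.1 q.2}.

Definition vec w (i : nat) : X := (nth (0, 1) w i).1.
Definition evals w : seq C := [seq q.2 | q <- w].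

(** Coefficients are indexed by [nat], so that one sequence of angles serves a family and all its
    extensions. *)
Definition lincomb w c : X := \sum_(i < size w) c i *: vec w i.
Definition nsum w : R := \sum_(i < size w) nrm (vec w i).
Definition psum w : R := \sum_(i < size w) nrm (vec w i) `^ p.

Lemma vec_cat w v i : vec (w ++ v) i =
  if (i < size w)%N then vec w i else vec v (i - size w).
Proof. by rewrite /vec nth_cat; case: ifP. Qed.

Lemma lincomb_cat w v c : lincomb (w ++ v) c = lincomb w c + lincomb v (fun i => c (size w + i)%N).
Proof.
rewrite /lincomb size_cat big_split_ord /=; congr (_ + _); apply: eq_bigr => i _.
  by rewrite vec_cat ltn_ord.
by rewrite vec_cat ltnNge leq_addr /= addKn.
Qed.

Lemma psum_cat w v : psum (w ++ v) = psum w + psum v.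
Proof.
rewrite /psum size_cat big_split_ord /=; congr (_ + _); apply: eq_bigr => i _.
  by rewrite vec_cat ltn_ord.
by rewrite vec_cat ltnNge leq_addr /= addKn.
Qed.

Lemma nsum_ge0 w : 0 <= nsum w.
Proof. by apply: sumr_ge0 => i _; exact: nrm_ge0. Qed.

Lemma eq_lincomb w c d : (forall i, (i < size w)%N -> c i = d i) -> lincomb w c = lincomb w d.
Proof. by move=> cd; apply: eq_bigr => i _; rewrite cd. Qed.

Lemma lincomb_lip w c d (e : R) : (forall i, (i < size w)%N -> cabs (c i - d i) <= e) ->
  nrm (lincomb w c - lincomb w d) <= e * nsum w.
Proof.
move=> h; rewrite /lincomb -sumrB (le_trans (nrm_sum _ _ _))// mulr_sumr.
apply: ler_sum => i _; rewrite -scalerBl nrmZ ler_wpM2r ?nrm_ge0//.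
exact: h.
Qed.

Lemma evals_nth w i : (i < size w)%N -> (evals w)`_i = (nth (0, 1) w i).2.
Proof. by move=> iw; rewrite /evals (nth_map (0, 1)). Qed.

Lemma size_evals w : size (evals w) = size w.
Proof. exact: size_map. Qed.

Lemma eigfam_cat w v : eigfam w -> eigfam v -> eigfam (w ++ v).
Proof. by move=> ew ev q; rewrite mem_cat => /orP[/ew|/ev]. Qed.

Lemma eigfam_nth w i : eigfam w -> (i < size w)%N ->
  unimodular_eigen T (vec w i) (evals w)`_i.
Proof. by move=> ew iw; rewrite evals_nth//; apply: ew; rewrite mem_nth. Qed.

Lemma unimod_evals w : eigfam w -> unimod (evals w).
Proof.
by move=> ew; apply/allP => z /mapP[q /ew[_ [q1 _]] ->]; apply/eqP.
Qed.

Lemma iter_eigen n u (l : C) : T u = l *: u -> iter n T u = l ^+ n *: u.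
Proof.
by move=> h; elim: n => [|n /= ->]; rewrite ?expr0 ?scale1r// linearZ /= h scalerA -exprSr.
Qed.

Lemma iter_lincomb n w c : eigfam w ->
  iter n T (lincomb w c) = lincomb w (fun i => (evals w)`_i ^+ n * c i).
Proof.
move=> ew; rewrite /lincomb iter_linsum; apply: eq_bigr => i _.
rewrite iter_linZ (@iter_eigen _ _ (evals w)`_i) ?scalerA; last first.
  by have [_ []] := eigfam_nth ew (ltn_ord i).
by rewrite mulrC.
Qed.

(** The bound does not depend on [n], because powers of the eigenvalues are unimodular. *)
Lemma iter_lincomb_lip n w c d (e : R) : eigfam w ->
  (forall i, (i < size w)%N -> cabs (c i - d i) <= e) ->
  nrm (iter n T (lincomb w c) - iter n T (lincomb w d)) <= e * nsum w.
Proof.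
move=> ew h; rewrite !iter_lincomb//; apply: lincomb_lip => i iw.
rewrite -mulrBr cabsM (@cabs_unimodular _ (_ ^+ n)) ?mul1r ?h//.
by rewrite normrX (unimod_nth (unimod_evals ew)) ?size_evals// expr1n.
Qed.

(** * Small eigenvector families that reach prescribed balls *)

Hypothesis p1 : 1 < p.
Hypothesis Xp : has_type X p.

(** Were all signed sums of norm at least [r], their average would be at least [r] to the power [p],
    against the type inequality once [psum v] is small. *)
Lemma small_signs (r : R) : 0 < r -> exists2 e : R, 0 < e &
  forall v, psum v <= e -> exists c, (forall i, `|c i| = 1) /\ nrm (lincomb v c) < r.
Proof.
move=> r0; have [C' hC'] := Xp; pose K := Num.max C' 0.
have K0 : 0 <= K by rewrite le_max lexx orbT.
exists (r `^ p / (K + 1)); first by rewrite divr_gt0 ?powR_gt0// ltr_wpDl.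
move=> v hv; apply: contrapT => /forallNP hno.
pose x (n : 'I_(size v)) := vec v n.
pose sg (eps : {ffun 'I_(size v) -> bool}) (i : nat) : C :=
  if insub i is Some j then (if eps j then 1 else -1) else 1.
have large (eps : {ffun 'I_(size v) -> bool}) :
    r `^ p <= nrm (\sum_n (if eps n then x n else - x n)) `^ p.
  have e1 : lincomb v (sg eps) = \sum_n (if eps n then x n else - x n).
    apply: eq_bigr => i _; rewrite /sg valK.
    by case: (eps i); rewrite ?scale1r ?scaleN1r.
  have := hno (sg eps); rewrite -e1 => /not_andP[[]|/negP].
    by move=> i; rewrite /sg; case: insub => [j|]; [case: (eps j)|]; rewrite ?normrN1 ?normr1.
  rewrite -leNgt => h; apply: ge0_ler_powR => //; rewrite ?nnegrE ?nrm_ge0 ?(ltW r0)//.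
  by rewrite ltW// (lt_trans _ p1).
have := hC' _ x; apply/negP; rewrite -ltNge.
have : (2 ^+ size v)^-1 * \sum_(eps : {ffun 'I_(size v) -> bool}) r `^ p <=
  (2 ^+ size v)^-1 * \sum_(eps : {ffun 'I_(size v) -> bool})
     nrm (\sum_n (if eps n then x n else - x n)) `^ p.
  by rewrite ler_wpM2l ?invr_ge0 ?exprn_ge0//; apply: ler_sum => eps _; exact: large.
apply: lt_le_trans.
rewrite sumr_const card_ffun card_bool card_ord -[r `^ p *+ _]mulr_natl natrX mulKf ?expf_neq0 ?pnatr_eq0//.
have rp : 0 < r `^ p by rewrite powR_gt0.
apply: (@le_lt_trans _ _ (K * (r `^ p / (K + 1)))).
  apply: (@le_trans _ _ (K * psum v)); last by rewrite ler_wpM2l.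
  rewrite ler_wpM2r ?le_max ?lexx//.
  by apply: sumr_ge0 => i _; exact: powR_ge0.
by rewrite mulrCA -[ltRHS]mulr1 ltr_pM2l// ltr_pdivrMr ?mul1r ?ltr_pwDr.
Qed.

Hypothesis cT : continuous T.
Variable C0 : R.
Hypothesis hC0 : forall Omega : set X,
  open Omega -> Omega !=set0 -> T @^-1` Omega `<=` Omega ->
  exists (n : nat) (u : 'I_n -> X) (lam : 'I_n -> R[i]),
    (forall k, unimodular_eigen T (u k) (lam k)) /\
    independent_family lam /\
    Omega (\sum_(k < n) u k) /\
    \sum_(k < n) (nrm (u k)) `^ p <= C0.

Let p_gt0 : 0 < p. Proof. exact: lt_trans p1. Qed.

(* The hypothesis is applied to a small dilate of [Omega], so that the
   vectors obtained are as small as we please. *)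
Lemma small_independent_family (b : X) (r e : R) : 0 < r -> 0 < e ->
  exists (n : nat) (u : 'I_n -> X) (lam : 'I_n -> R[i]),
    [/\ forall k, unimodular_eigen T (u k) (lam k), independent_family lam,
        \sum_(k < n) (nrm (u k)) `^ p <= e &
        exists N : nat, nrm (iter N T (\sum_(k < n) u k) - b) < r].
Proof.
move=> r0 e0; pose K := Num.max C0 0 + 1.
have K0 : 0 < K by rewrite ltr_wpDl// le_max lexx orbT.
pose s := (e / K) `^ p^-1.
have s0 : 0 < s by rewrite powR_gt0// divr_gt0.
have sp : s `^ p = e / K by rewrite -powRrM mulVf ?gt_eqF// powRr1// divr_ge0 ?ltW.
pose Omega := [set x : X | exists N : nat, nrm (s%:C%C *: iter N T x - b) < r].
have oO : open Omega.
  apply/open_nrmP => x [N hN]; pose g := (r - nrm (s%:C%C *: iter N T x - b)) / s.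
  have g0 : 0 < g by rewrite divr_gt0// subr_gt0.
  have [d d0 hd] := continuous_at0_nrm cT N g0; exists d => // y xy; exists N.
  rewrite (le_lt_trans (nrm_tri _ (s%:C%C *: iter N T x) _))// -ltrBrDr.
  rewrite -scalerBr nrmZ_real ?ltW// mulrC -ltr_pdivlMr//.
  by rewrite -iter_linN -iter_linD hd// nrm_sub.
have nO : Omega !=set0.
  exists (s^-1%:C%C *: b); exists 0%N; rewrite /= scalerA -rmorphM /= divff ?gt_eqF//.
  by rewrite rmorph1 scale1r subrr nrm0.
have sO : T @^-1` Omega `<=` Omega.
  by move=> x /= [N hN]; exists N.+1; rewrite iterSr.
have [n [u [lam [hu [il [[N hN] hs]]]]]] := hC0 oO nO sO.
exists n, (fun k => s%:C%C *: u k), lam; split => //.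
- move=> k; have [u0 [l1 Tu]] := hu k; split; [|split] => //.
    move/eqP; rewrite scaler_eq0 => /orP[/eqP/(congr1 (@complex.Re R))/= s0'|/eqP//].
    by rewrite s0' ltxx in s0.
  by rewrite linearZ /= Tu !scalerA mulrC.
- under eq_bigr do rewrite nrmZ_real ?(ltW s0)// powRM ?(ltW s0) ?nrm_ge0// sp.
  rewrite -mulr_sumr; apply: (@le_trans _ _ (e / K * K)); last by rewrite mulfVK// gt_eqF.
  rewrite ler_wpM2l ?divr_ge0 ?(ltW e0) ?(ltW K0)// (le_trans hs)// ltW//.
  by rewrite ltr_pwDr// le_max lexx.
- by exists N; rewrite -scaler_sumr iter_linZ.
Qed.

(** Exchange keeps a subfamily independent modulo [lam] and drops at most [size lam] vectors, each
    so small that the dropped part of the orbit is below [r / 2]. The rotation reaching [b] is [T]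
    iterated [N] times; the one reaching [0] is a choice of signs. *)
Lemma single_target (lam : seq C) (b : X) (r e : R) : unimod lam -> 0 < r -> 0 < e ->
  exists v, [/\ eigfam v, indep_over lam (evals v), psum v <= e,
    exists c, (forall i, `|c i| = 1) /\ nrm (lincomb v c - b) < r &
    exists c, (forall i, `|c i| = 1) /\ nrm (lincomb v c) < r].
Proof.
move=> ul r0 e0; have r2 : 0 < r / 2 by rewrite divr_gt0.
have [e1 e10 he1] := small_signs r0.
pose q := r / 2 / (size lam).+1%:R.
have q0 : 0 < q by rewrite divr_gt0.
(* The three bounds serve the estimate on [psum], the sign choice near [0], and the bound [q] on the
   norm of each dropped vector. *)
pose e' := Num.min e (Num.min e1 (q `^ p)).
have e'0 : 0 < e' by rewrite !lt_min e0 e10 powR_gt0.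
have [n [u [mu [hu imu hs [N hN]]]]] := small_independent_family b r2 e'0.
have mu1 k : `|mu k| = 1 by have [_ []] := hu k.
have [s [us ss is_]] := exchange_indep_over mu1 ul imu.
pose v := [seq (u k, mu k) | k <- s].
have ev : eigfam v by move=> _ /mapP[k _ ->]; exact: hu.
have bigv (Y : zmodType) (F : X * C -> Y) :
    \sum_(i < size v) F (nth (0, 1) v i) = \sum_(k in s) F (u k, mu k).
  by rewrite -(big_mkord xpredT (fun i => F (nth (0, 1) v i))) -(big_nth (0, 1) xpredT F)
    big_map big_uniq.
have pv : psum v <= e'.
  rewrite /psum (bigv _ (fun q => nrm q.1 `^ p)) /=; apply: le_trans hs.
  rewrite [leRHS](bigID (fun k => k \in s)) /= lerDl.
  by apply: sumr_ge0 => k _; exact: powR_ge0.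
exists v; split => //.
- by rewrite /evals -map_comp.
- by apply: (le_trans pv); rewrite ge_min lexx.
- exists (fun i => if (i < size v)%N then (evals v)`_i ^+ N else 1); split.
    move=> i; case: ifP => [iv|]; last by rewrite normr1.
    by rewrite normrX (unimod_nth (unimod_evals ev)) ?size_evals// expr1n.
  have -> : lincomb v (fun i => if (i < size v)%N then (evals v)`_i ^+ N else 1) =
            \sum_(k in s) mu k ^+ N *: u k.
    rewrite -(bigv _ (fun q => q.2 ^+ N *: q.1)); apply: eq_bigr => i _.
    by rewrite ltn_ord evals_nth.
  have whole : iter N T (\sum_(k < n) u k) =
      \sum_(k in s) mu k ^+ N *: u k + \sum_(k | k \notin s) mu k ^+ N *: u k.
    rewrite iter_linsum (bigID (fun k => k \in s)) /=; congr (_ + _);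
    by apply: eq_bigr => k _; have [_ [_ Tu]] := hu k; exact: iter_eigen.
  have rest : nrm (\sum_(k | k \notin s) mu k ^+ N *: u k) < r / 2.
    apply: (@le_lt_trans _ _ (\sum_(k | k \notin s) q)).
      apply: (le_trans (nrm_sum _ _ _)); apply: ler_sum => k _.
      rewrite nrmZ (@cabs_unimodular _ (_ ^+ N)) ?mul1r ?normrX ?mu1 ?expr1n//.
      have : nrm (u k) `^ p <= q `^ p.
        apply: (@le_trans _ _ e'); last by rewrite /e' !ge_min lexx !orbT.
        apply: le_trans hs; rewrite (bigD1 k)//= lerDl.
        by apply: sumr_ge0 => j _; exact: powR_ge0.
      by rewrite leNgt => h; rewrite leNgt; apply: contra h; apply: gt0_ltr_powR;
        rewrite ?nnegrE ?nrm_ge0 ?(ltW q0).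
    rewrite sumr_const -[q *+ _]mulr_natl /q mulrCA -[ltRHS]mulr1 ltr_pM2l//.
    rewrite ltr_pdivrMr// mul1r ltr_nat ltnS.
    have := cardC (mem s); rewrite card_ord (card_uniqP us) => cE.
    have -> : #|[pred k | k \notin s]| = #|[predC s]| by apply: eq_card.
    by rewrite -(leq_add2l (size s)) cE.
  move: hN; rewrite whole => hN.
  set a := \sum_(k in s) _ in hN *; set a' := \sum_(k | _) _ in rest hN.
  rewrite (_ : a - b = (a + a' - b) - a'); last by rewrite [a + a' - b]addrAC addrK.
  by rewrite (le_lt_trans (nrmD _ _))// nrmN [ltRHS]splitr ltrD.
- by apply: he1; apply: (le_trans pv); rewrite /e' !ge_min lexx !orbT.
Qed.

(** One family is added per target, independent over [lam] and the earlier ones. To hit the new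
    target the earlier families are rotated near [0]; to hit an old one, the new family is. This is
    why [0] belongs to the list. *)
Lemma multi_target (lam : seq C) (bs : seq X) (r e : R) : unimod lam -> 0 < r -> 0 < e ->
  exists v, [/\ eigfam v, indep_over lam (evals v), psum v <= e &
    {in 0 :: bs, forall b, exists c, (forall i, `|c i| = 1) /\ nrm (lincomb v c - b) < r}].
Proof.
move=> ul; elim: bs r e => [|b bs IH] r e r0 e0.
  exists [::]; split=> //; first by rewrite /psum big_ord0 ltW.
  move=> b; rewrite inE => /eqP->; exists (fun=> 1); split=> [i|]; first by rewrite normr1.
  by rewrite /lincomb big_ord0 subrr nrm0.
have r2 : 0 < r / 2 by rewrite divr_gt0.
have e2 : 0 < e / 2 by rewrite divr_gt0.
have [v1 [ev1 iv1 pv1 t1]] := IH _ _ r2 e2.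
have ul1 : unimod (evals v1 ++ lam) by rewrite unimod_cat unimod_evals.
have [v2 [ev2 iv2 pv2 [c2 [c21 hc2]] [c20 [c201 hc20]]]] := single_target b ul1 r2 e2.
exists (v2 ++ v1); split.
- exact: eigfam_cat.
- by rewrite /evals map_cat; exact: indep_over_cat.
- by rewrite psum_cat [leRHS]splitr lerD.
pose glue (c c' : nat -> C) i := if (i < size v2)%N then c i else c' (i - size v2)%N.
have glueE c c' : lincomb (v2 ++ v1) (glue c c') = lincomb v2 c + lincomb v1 c'.
  rewrite lincomb_cat; congr (_ + _); apply: eq_lincomb => i iv; rewrite /glue.
    by rewrite iv.
  by rewrite ltnNge leq_addr /= addKn.
have glue1 c c' : (forall i, `|c i| = 1) -> (forall i, `|c' i| = 1) ->
    forall i, `|glue c c' i| = 1.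
  by move=> h h' i; rewrite /glue; case: ifP.
move=> y; rewrite !inE orbCA => /orP[/eqP->|ybs].
  have [|c1 [c11 hc1]] := t1 0; first by rewrite inE eqxx.
  exists (glue c2 c1); split; first exact: glue1.
  rewrite glueE addrAC (le_lt_trans (nrmD _ _))// [ltRHS]splitr ltrD//.
  by rewrite subr0 in hc1.
have [|c1 [c11 hc1]] := t1 y; first by rewrite inE.
exists (glue c20 c1); split; first exact: glue1.
by rewrite glueE -addrA (le_lt_trans (nrmD _ _))// [ltRHS]splitr ltrD.
Qed.

(** The targets are the differences between [a] and the values of [w] at the points of a finite net
    of angles. Kronecker's theorem then gives a time at which [T] nearly fixes the part on [w] and
    rotates the part on [v] to the target of the nearest net point. *)
Lemma step_visit w (a : X) (r e : R) : eigfam w -> 0 < r -> 0 < e ->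
  exists v, [/\ eigfam v, psum v <= e &
    forall t, in01 t -> exists n : nat,
      nrm (iter n T (lincomb (w ++ v) (fun j => chi (t j))) - a) < r].
Proof.
move=> ew r0 e0; have r4 : 0 < r / 4 by rewrite divr_gt0.
have ns0 w' : 0 < nsum w' + 1 by rewrite ltr_wpDl ?nsum_ge0.
pose h := r / 4 / (nsum w + 1); have h0 : 0 < h by rewrite divr_gt0.
have bnd w' (d : R) : 0 < d -> d / (nsum w' + 1) * nsum w' <= d.
  move=> d0; rewrite mulrAC ler_pdivrMr// ler_wpM2l ?(ltW d0)//.
  by rewrite lerDl.
have [F [g [g01 hg]]] := finite_angle_net (size w) h0.
pose bs := [seq a - lincomb w (fun j => chi (g f j)) | f <- enum F].
have [v [ev iv pv tv]] := multi_target bs (unimod_evals ew) r4 e0.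
exists v; split=> // t t01.
have [f hf] := hg t t01.
have [|c [c1 hc]] := tv (a - lincomb w (fun j => chi (g f j))).
  by rewrite inE; apply/orP; right; apply/mapP; exists f => //; rewrite mem_enum.
pose k := r / 4 / (nsum w + nsum v + 1).
have N0 : 0 < nsum w + nsum v + 1 by rewrite ltr_wpDl// addr_ge0 ?nsum_ge0.
have k0 : 0 < k by rewrite divr_gt0.
(* Dividing by the current phase of [v] makes the power of the eigenvalue carry that phase to
   [c i]. *)
pose d i := c i / chi (t (size w + i)%N).
have d1 i : `|d i| = 1 by rewrite normrM normfV norm_chi c1 invr1 mulr1.
have [n [hw hv]] := kronecker_over (unimod_evals ew) (unimod_evals ev) iv d1 k0.
exists n; rewrite lincomb_cat iter_linD !iter_lincomb//.
set A := lincomb w _; set B := lincomb v _.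
have hA : nrm (A - lincomb w (fun j => chi (t j))) <= k * nsum w.
  apply: lincomb_lip => i iw; rewrite -{2}[chi _]mul1r -mulrBl cabsM cabs_chi mulr1 ltW//.
  by rewrite hw// size_evals.
have hB : nrm (B - lincomb v c) <= k * nsum v.
  apply: lincomb_lip => i iw.
  have -> : (evals v)`_i ^+ n * chi (t (size w + i)%N) - c i =
            ((evals v)`_i ^+ n - d i) * chi (t (size w + i)%N).
    by rewrite mulrBl /d mulfVK// unimodular_neq0// norm_chi.
  by rewrite cabsM cabs_chi mulr1 ltW// hv// size_evals.
have hg' : nrm (lincomb w (fun j => chi (t j)) - lincomb w (fun j => chi (g f j))) <= h * nsum w.
  exact: lincomb_lip.
have hh := bnd w _ r4; rewrite -/h in hh.
have hk : k * nsum w + k * nsum v <= r / 4.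
  rewrite -mulrDr /k mulrAC ler_pdivrMr// ler_wpM2l ?(ltW r4)//.
  by rewrite lerDl.
set A1 := lincomb w _ in hA hg'; set A2 := lincomb w _ in hg' hc.
have -> : A + B - a = (A - A1) + ((A1 - A2) + ((B - lincomb v c) + (lincomb v c - (a - A2)))).
  rewrite [B - _ + _]addrA subrK opprB [A1 - A2 + _]addrACA addKr -(addrA A1).
  by rewrite [A - A1 + _]addrA subrK addrA.
apply: (le_lt_trans (nrmD _ _)).
have t1 := nrmD (A1 - A2) ((B - lincomb v c) + (lincomb v c - (a - A2))).
have t2 := nrmD (B - lincomb v c) (lincomb v c - (a - A2)).
lra.
Qed.

Lemma finite_pos_lower (F : finType) (f : F -> R) : (forall i, 0 < f i) ->
  exists2 m, 0 < m & forall i, m <= f i.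
Proof.
move=> f0; exists (\big[Num.min/1]_i f i); last by move=> i; exact: bigmin_le_cond.
by elim/big_ind: _ => // x y x0 y0; rewrite lt_min x0.
Qed.

(** Only the visiting times of finitely many net points are used, so continuity of finitely many
    iterates gives one [rho]. Passing from [t] to its net point costs the same at every time. *)
Lemma step_margin w (a : X) (r e : R) : eigfam w -> 0 < r -> 0 < e ->
  exists v, [/\ eigfam v, psum v <= e &
    exists2 rho : R, 0 < rho & forall t, in01 t -> forall z, nrm z < rho -> exists n : nat,
      nrm (iter n T (lincomb (w ++ v) (fun j => chi (t j)) + z) - a) < r].
Proof.
move=> ew r0 e0; have r2 : 0 < r / 2 by rewrite divr_gt0.
have r4 : 0 < r / 4 by rewrite divr_gt0.
have [v [ev pv hv]] := step_visit a ew r2 e0; exists v; split=> //.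
have ewv := eigfam_cat ew ev; set W := w ++ v in ewv hv *.
have ns0 : 0 < nsum W + 1 by rewrite ltr_wpDl ?nsum_ge0.
pose h := r / 4 / (nsum W + 1); have h0 : 0 < h by rewrite divr_gt0.
have [F [g [g01 hg]]] := finite_angle_net (size W) h0.
have [N hN] := choice (fun f => hv (g f) (g01 f)).
have hrho f : exists d : R, 0 < d /\ forall z, nrm z < d -> nrm (iter (N f) T z) < r / 4.
  by have [d d0 hd] := continuous_at0_nrm cT (N f) r4; exists d.
have [rho_ hrho_] := choice hrho.
have [rho rho0 hr] := finite_pos_lower (fun f => (hrho_ f).1).
exists rho => // t t01 z hz; have [f hf] := hg t t01; exists (N f).
have h1 := hN f.
have h2 : nrm (iter (N f) T (lincomb W (fun j => chi (t j))) -
               iter (N f) T (lincomb W (fun j => chi (g f j)))) <= r / 4.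
  apply: (le_trans (iter_lincomb_lip _ ewv hf)).
  by rewrite /h mulrAC ler_pdivrMr// ler_wpM2l ?(ltW r4)// lerDl.
have h3 := (hrho_ f).2 z (lt_le_trans hz (hr f)).
rewrite iter_linD; move: h1 h2 h3.
set A := iter _ T (lincomb W _); set B := iter _ T (lincomb W _); set Z := iter _ T z => h1 h2 h3.
have -> : B + Z - a = (B - A) + ((A - a) + Z) by rewrite !addrA subrK addrAC.
have := nrmD (B - A) ((A - a) + Z); have := nrmD (A - a) Z; lra.
Qed.

End Families.

(** * The Prokhorov topology *)

Section Enlargement.
Variables (R : realType) (X : normedModType R[i]).
Implicit Types (A B U : set X) (e : R) (m : Pmeas X).

Lemma open_measurable_BX A : open A -> measurable (A : set (BX X)).
Proof. by move=> oA; exact: sub_sigma_algebra. Qed.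

Lemma enl_open A e : open (enl A e).
Proof.
apply/open_nrmP => x [y Ay xy]; exists (e - nrm (x - y)); first by rewrite subr_gt0.
move=> z xz; exists y => //; rewrite (le_lt_trans (nrm_tri _ x _))//.
by rewrite -ltrBrDr nrm_sub.
Qed.

Lemma enl_measurable A e : measurable (enl A e : set (BX X)).
Proof. by apply: open_measurable_BX; exact: enl_open. Qed.

Lemma enl_sub A B e e' : A `<=` B -> e <= e' -> enl A e `<=` enl B e'.
Proof. by move=> AB ee x [y /AB By xy]; exists y => //; exact: lt_le_trans ee. Qed.

Lemma enl_enl A e e' : enl (enl A e) e' `<=` enl A (e + e').
Proof.
move=> x [y [z Az yz] xy]; exists z => //.
by rewrite (le_lt_trans (nrm_tri _ y _))// [ltRHS]addrC ltrD.
Qed.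

(** These sets exhaust an open [U] from inside while their [e]-enlargement stays in [U], which turns
    Prokhorov closeness into lower bounds on [U]. *)
Definition inner U e : set X := [set x | forall z, nrm z < e -> U (x + z)].

Lemma innerE U e : inner U e = ~` enl (~` U) e.
Proof.
apply/seteqP; split=> x /= h.
  by move=> [y Uy xy]; apply: Uy; rewrite -[y](subrK x) addrC; apply: h; rewrite nrm_sub.
move=> z ze; apply: contrapT => Uz; apply: h; exists (x + z) => //.
by rewrite opprD addrA subrr add0r nrmN.
Qed.

Lemma inner_measurable U e : measurable (inner U e : set (BX X)).
Proof. by rewrite innerE; apply: measurableC; exact: enl_measurable. Qed.

Lemma enl_inner U e : enl (inner U e) e `<=` U.
Proof. by move=> x [y hy xy]; rewrite -[x](subrK y) addrC; exact: hy. Qed.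

Lemma inner_sub U e e' : e <= e' -> inner U e' `<=` inner U e.
Proof. by move=> ee x h z ze; apply: h; exact: lt_le_trans ee. Qed.

Lemma inner_cover U : open U -> U = \bigcup_n inner U n.+1%:R^-1.
Proof.
move=> /open_nrmP oU; apply/seteqP; split=> [x Ux|x [n _ /(_ 0)]]; last first.
  by rewrite nrm0 addr0 invr_gt0 ltr0n; exact.
have [e e0 he] := oU x Ux; exists (Num.truncn e^-1) => // z ze; apply: he.
rewrite opprD addrA subrr add0r nrmN (lt_trans ze)//.
by rewrite invf_plt ?posrE// truncnS_gt.
Qed.

Definition pr m A : R := fine (m (A : set (BX X))).

Lemma prE m A : measurable (A : set (BX X)) -> m (A : set (BX X)) = (pr m A)%:E.
Proof. by move=> mA; rewrite /pr fineK// fin_num_measure. Qed.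

Lemma pr_setC m A : measurable (A : set (BX X)) -> pr m (~` A) = 1 - pr m A.
Proof.
by move=> mA; rewrite /pr (probability_setC m mA) (prE m mA).
Qed.

Lemma pr_le m A B : measurable (A : set (BX X)) -> measurable (B : set (BX X)) ->
  A `<=` B -> pr m A <= pr m B.
Proof.
by move=> mA mB AB; rewrite -lee_fin -!prE// le_measure ?inE.
Qed.

(* Taking complements turns one inequality of [pclose] into the other. *)
Lemma pclose_one_sided m1 m2 e :
  (forall A : set (BX X), measurable A -> (m1 A <= m2 (enl A e) + e%:E)%E) -> pclose m1 m2 e.
Proof.
move=> h A mA; split; first exact: h.
have mE := enl_measurable A e; have mEC := measurableC mE.
have mEE := enl_measurable (~` enl A e) e.
have := h _ mEC; rewrite !prE// -!EFinD !lee_fin pr_setC//.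
suff : pr m2 (enl (~` enl A e) e) <= pr m2 (~` A).
  by rewrite pr_setC//; lra.
apply: pr_le => //; first exact: measurableC.
by move=> x [y Ey xy] Ax; apply: Ey; exists x => //; rewrite nrm_sub.
Qed.

Lemma pclose_trans m1 m2 m3 e e' :
  pclose m1 m2 e -> pclose m2 m3 e' -> pclose m1 m3 (e + e').
Proof.
move=> h12 h23; apply: pclose_one_sided => A mA.
have [h1 _] := h12 A mA; have [h2 _] := h23 _ (enl_measurable A e).
have h3 : pr m3 (enl (enl A e) e') <= pr m3 (enl A (e + e')).
  by apply: pr_le; [exact: enl_measurable..|exact: enl_enl].
move: h1 h2; rewrite !prE//; try exact: enl_measurable.
rewrite -!EFinD !lee_fin; lra.
Qed.

(** By continuity from below some [inner] set already has mass above [c]; a measure close to [m]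
    gives its enlargement, still inside [U], almost that mass. *)
Lemma popen_gt U (c : R) : open U -> popen [set m : Pmeas X | (c%:E < m (U : set (BX X)))%E].
Proof.
move=> oU m /= cm; have mU := open_measurable_BX oU.
have mI n : measurable (inner U n.+1%:R^-1 : set (BX X)) := inner_measurable U _.
have : (m \o (fun n => inner U n.+1%:R^-1 : set (BX X))) @ \oo -->
       m (\bigcup_n (inner U n.+1%:R^-1 : set (BX X))).
  apply: nondecreasing_cvg_mu => //; first by rewrite -inner_cover.
  move=> i j ij; apply/subsetPset; apply: inner_sub.
  by rewrite lef_pV2 ?posrE ?ler_nat ?ltr0n.
rewrite -inner_cover// => /(_ [set y | (c%:E < y)%E]) /=.
case=> [|n _ /(_ n (leqnn n)) /=]; first exact: open_ereal_gt'.
move: cm; rewrite prE// prE// !lte_fin => cm cn.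
pose e := Num.min n.+1%:R^-1 (pr m (inner U n.+1%:R^-1) - c).
have e0 : 0 < e by rewrite lt_min invr_gt0 ltr0n /= subr_gt0.
exists e => // m' [e' /andP[e'0 e'e] /(_ _ (mI n))[+ _]] /=.
have mE := enl_measurable (inner U n.+1%:R^-1) e'.
rewrite prE// prE// prE// -EFinD lee_fin lte_fin => h.
have : pr m' (enl (inner U n.+1%:R^-1) e') <= pr m' U.
  apply: pr_le => //; apply: subset_trans (@enl_inner U n.+1%:R^-1).
  by apply: enl_sub => //; rewrite ltW// (lt_le_trans e'e)// ge_min lexx.
have : e <= pr m (inner U n.+1%:R^-1) - c by rewrite ge_min lexx orbT.
lra.
Qed.

Lemma prob_bigcap_open m (U : nat -> set X) : (forall i, open (U i)) ->
  (m (\bigcap_i U i : set (BX X)) = 1%E) <-> (forall i, m (U i : set (BX X)) = 1%E).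
Proof.
move=> oU; have mU i : measurable (U i : set (BX X)) := open_measurable_BX (oU i).
have mI : measurable (\bigcap_i U i : set (BX X)) by apply: bigcapT_measurable.
split=> [h i|h].
  apply/eqP; rewrite eq_le probability_le1//= -h le_measure ?inE//.
  exact: bigcap_inf.
have : m.-negligible (\bigcup_i ~` U i : set (BX X)).
  apply: negligible_bigcup => i; apply/negligibleP; first exact: measurableC.
  by rewrite [LHS](probability_setC m (mU i)) h subee.
move/negligibleP => /(_ (bigcupT_measurable _ (fun i => measurableC (mU i)))).
rewrite -setC_bigcap [LHS](probability_setC m mI).
rewrite prE// -EFinB => -[] /eqP; rewrite subr_eq0 => /eqP <- //.
Qed.

(** Probability one on the intersection means [m (U i) > 1 - 1 / (j + 1)] for all pairs [(i, j)],
    each an open condition. Integers coding no pair contribute [setT]. *)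
Lemma pGdelta_prob1 (Y : set (Pmeas X)) (U : nat -> set X) : (forall i, open (U i)) ->
  pGdelta_in Y [set m | Y m /\ m (\bigcap_i U i : set (BX X)) = 1%E].
Proof.
move=> oU; have mU i : measurable (U i : set (BX X)) := open_measurable_BX (oU i).
pose V n : set (Pmeas X) := if @unpickle (nat * nat)%type n is Some ij
  then [set m : Pmeas X | ((1 - ij.2.+1%:R^-1)%:E < m (U ij.1 : set (BX X)))%E] else setT.
exists V.
  move=> n; rewrite /V; case: unpickle => [ij|]; first exact: popen_gt.
  by move=> m _; exists 1 => //.
apply/seteqP; split=> m [Ym h]; split => //.
  move: h => /(prob_bigcap_open _ oU) h n _; rewrite /V; case: unpickle => // -[i j] /=.
  by rewrite h lte_fin ltrBlDr ltrDl invr_gt0 ltr0n.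
apply/(prob_bigcap_open _ oU) => i.
apply/eqP; rewrite eq_le probability_le1//= prE// lee_fin.
apply/ler_addgt0Pr => e e0.
have := h (pickle (i, Num.truncn e^-1)) I; rewrite /V pickleK /= prE// lte_fin.
have hi : (Num.truncn e^-1).+1%:R^-1 < e by rewrite invf_plt ?posrE// truncnS_gt.
by rewrite ltrBlDr => /ltW/le_trans; apply; rewrite lerD2l ltW.
Qed.

End Enlargement.

(** * Hypercyclic vectors as a countable intersection of open sets *)

Section Hypercyclic.
Variables (R : realType) (X : normedModType R[i]) (T : {linear X -> X}).
Hypothesis cT : continuous T.

Definition visit (a : X) (r : R) : set X := [set x | exists n : nat, nrm (iter n T x - a) < r].

Lemma visit_open a r : open (visit a r).
Proof.
apply/open_nrmP => x [N hN]; have g0 : 0 < r - nrm (iter N T x - a) by rewrite subr_gt0.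
have [d d0 hd] := continuous_at0_nrm cT N g0; exists d => // y xy; exists N.
rewrite (le_lt_trans (nrm_tri _ (iter N T x) _))// -ltrBrDr.
by rewrite -iter_linN -iter_linD hd// nrm_sub.
Qed.

Lemma separable_seq : separable_space X ->
  exists d : nat -> X, forall x e, 0 < e -> exists k, nrm (x - d k) < e.
Proof.
move=> [D [cD dD]].
have /pcard_surjP[g gD] : (D #<= [set: nat])%card by [].
exists g => x e e0.
have [||y [xy /gD[k _ ky]]] := dD [set y | nrm (x - y) < e]; last by exists k; rewrite ky.
  by exists x; rewrite /= subrr nrm0.
rewrite (_ : [set _ | _] = enl [set x] e); first exact: enl_open.
by apply/seteqP; split=> y /=; [exists x => //|move=> [_ ->]]; rewrite nrm_sub.
Qed.

(** The triple codes a centre, a radius and a repetition index, by which each visiting set occurs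
    infinitely often in the enumeration. *)
Lemma HC_bigcap (d : nat -> X) : (forall x e, 0 < e -> exists k, nrm (x - d k) < e) ->
  HC T = \bigcap_n (if @unpickle (nat * nat * nat)%type n is Some q
                    then visit (d q.1.1) q.1.2.+1%:R^-1 else setT).
Proof.
move=> hd; apply/seteqP; split=> x hx.
  move=> n _; case: unpickle => // -[[k j] l] /=.
  have r0 : 0 < j.+1%:R^-1 :> R by rewrite invr_gt0.
  have [||y [yB [N _ Ny]]] := hx (enl [set d k] j.+1%:R^-1).
  - by exists (d k); exists (d k) => //; rewrite subrr nrm0.
  - exact: enl_open.
  - by move: yB => [_ -> h]; exists N; rewrite Ny.
move=> O [y Oy] /open_nrmP/(_ y Oy)[e e0 he].
have e2 : 0 < e / 2 by rewrite divr_gt0.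
have [k hk] := hd y _ e2.
have := hx (pickle (k, Num.truncn (e / 2)^-1, 0%N)) I; rewrite pickleK /= => -[N hN].
exists (iter N T x); split; last by exists N.
apply: he; rewrite (le_lt_trans (nrm_tri _ (d k) _))// [ltRHS]splitr ltrD//.
rewrite nrm_sub (lt_trans hN)// invf_plt ?posrE// truncnS_gt//.
Qed.

End Hypercyclic.

(** * Steinhaus laws *)

Section ProbabilityOfSetFunction.
Context (R : realType) (dT : measure_display) (T : measurableType dT).
Variable f : set T -> \bar R.
Hypotheses (f0 : f set0 = 0%E) (f_ge0 : forall A, (0 <= f A)%E)
  (f_add : semi_sigma_additive f) (f1 : f setT = 1%E).

(** An alias of [f] that takes the measure axioms as arguments, so that the measure structure can be
    attached to it. *)
Let g (_ : f set0 = 0%E) (_ : forall A, (0 <= f A)%E)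
  (_ : semi_sigma_additive f) := f.

Let mu := g f0 f_ge0 f_add.

HB.instance Definition _ := isMeasure.Build _ _ _ mu f0 f_ge0 f_add.
HB.instance Definition _ := Measure_isProbability.Build _ _ _ mu f1.

Lemma probability_of_set_function : exists m : probability T R, forall A, m A = f A.
Proof. by exists mu. Qed.

End ProbabilityOfSetFunction.

Section SteinhausLaw.
Variables (R : realType) (X : normedModType R[i]).
Variable d : nat -> X.
Hypothesis hd : forall x e, 0 < e -> exists k, nrm (x - d k) < e.

Section Translate.
Variable x0 : X.

Lemma chi_shift_measurable (y : X) (U : set X) : open U ->
  measurable ([set t : R | U (chi t *: x0 + y)] : set R).
Proof.
move=> oU; apply: open_measurable; rewrite openE => t /= Ut.
move: oU => /open_nrmP/(_ _ Ut)[e e0 he].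
have n0 : 0 < nrm x0 + 1 by rewrite ltr_wpDl ?nrm_ge0.
have [a a0 ha] := chi_unif (divr_gt0 e0 n0).
apply/nbhs_ballP; exists a => //= s; rewrite -ball_normE /= => st; apply: (he (chi s *: x0 + y)).
rewrite opprD addrACA subrr addr0 -scalerBl nrmZ (le_lt_trans (ler_wpM2r (nrm_ge0 _) (ha _ _ st)))//.
by rewrite mulrAC ltr_pdivrMr// ltr_pM2l// ltrDl.
Qed.

(** Separability is what makes addition measurable for the product sigma-algebra: the preimage of an
    open set is a countable union of rectangles around the dense points [d k]. *)
Lemma translate_measurable :
  measurable_fun [set: R * BX X] (fun ty : R * BX X => (chi ty.1 *: x0 + ty.2 : BX X)).
Proof.
apply: (@measurability _ _ _ (BX X) _ _ (@open X)) => // _ [U oU <-]; rewrite setTI.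
have -> : (fun ty : R * BX X => chi ty.1 *: x0 + ty.2) @^-1` U =
    \bigcup_k \bigcup_j ([set t : R | inner U j.+1%:R^-1 (chi t *: x0 + d k)] `*`
                        (enl [set d k] j.+1%:R^-1 : set (BX X))).
  apply/seteqP; split=> [[t y] /= Uty|[t y] /= [k _ [j _ [/= h [_ -> yd]]]]]; last first.
    by have := h _ yd; rewrite -addrA [d k + _]addrC subrK.
  move: oU => /open_nrmP/(_ _ Uty)[e e0 he].
  pose j := Num.truncn (e / 2)^-1.
  have je : j.+1%:R^-1 < e / 2 by rewrite invf_plt ?posrE ?divr_gt0// truncnS_gt.
  have [|k hk] := @hd y j.+1%:R^-1; first by rewrite invr_gt0.
  exists k => //; exists j => //; split=> /=; last by exists (d k).
  move=> z zj; apply: he.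
  have -> : chi t *: x0 + y - (chi t *: x0 + d k + z) = (y - d k) - z.
    by rewrite -[_ + _ + z]addrA opprD addrACA subrr add0r opprD addrA.
  by rewrite (le_lt_trans (nrmD _ _))// nrmN [ltRHS]splitr ltrD// (lt_trans _ je).
apply: bigcupT_measurable => k; apply: bigcupT_measurable => j.
apply: measurableX; last exact: enl_measurable.
rewrite (_ : [set _ | _] = ~` [set t : R | enl (~` U) j.+1%:R^-1 (chi t *: x0 + d k)]).
  apply: measurableC; apply: chi_shift_measurable; exact: enl_open.
by rewrite innerE.
Qed.

Variable m : Pmeas X.

Definition shift_set (A : set X) (t : R) : set (BX X) := [set y | A (chi t *: x0 + y)].

Lemma shift_set_xsection (A : set (BX X)) t :
  shift_set A t = xsection ((fun ty : R * BX X => (chi ty.1 *: x0 + ty.2 : BX X)) @^-1` A) t.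
Proof. by rewrite xsectionE. Qed.

Let mpre (A : set (BX X)) : measurable A ->
  measurable ((fun ty : R * BX X => (chi ty.1 *: x0 + ty.2 : BX X)) @^-1` A).
Proof. by move=> mA; rewrite -[X in measurable X]setTI; exact: translate_measurable. Qed.

Lemma shift_set_measurable (A : set (BX X)) t : measurable A -> measurable (shift_set A t).
Proof. by move=> mA; rewrite shift_set_xsection; apply: measurable_xsection; exact: mpre. Qed.

Lemma measurable_prob_shift (A : set (BX X)) (D : set R) : measurable A -> measurable D ->
  measurable_fun D (fun t => m (shift_set A t)).
Proof.
move=> mA mD; apply: measurable_funTS.
under eq_fun do rewrite shift_set_xsection.
exact: (measurable_fun_xsection m (mpre mA)).
Qed.

(** This is the law of [chi t *: x0 + Y] with [t] uniform and [Y] of law [m], independent of [t]. *)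
Lemma translate_law : exists m' : Pmeas X, forall A : set (BX X),
  m' A = (\int[@lebesgue_measure R]_(t in `[0%R, 1%R]) m (shift_set A t))%E.
Proof.
apply: probability_of_set_function.
- by apply: integral0_eq => t _; rewrite measure0.
- by move=> A; apply: integral_ge0 => t _; exact: measure_ge0.
- move=> F mF tF mUF.
  rewrite [X in _ --> X](_ : _ = \sum_(n <oo)
    (\int[@lebesgue_measure R]_(t in `[0%R, 1%R]) m (shift_set (F n) t)))%E.
    by apply/cvg_closeP; split; [apply: is_cvg_nneseries => n _ _;
      exact: integral_ge0|rewrite closeE].
  rewrite -integral_nneseries//; last by move=> n; exact: measurable_prob_shift.
  apply: eq_integral => t _; apply/esym/cvg_lim => //=.
  have -> : shift_set (\bigcup_n F n) t = \bigcup_n shift_set (F n) t.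
    by rewrite /shift_set; apply/seteqP; split=> y [n _ h]; exists n.
  apply: measure_semi_sigma_additive.
  + by move=> n; exact: shift_set_measurable.
  + apply/trivIsetP => i j _ _ ij; move/trivIsetP: tF => /(_ i j I I ij) h.
    apply/seteqP; split=> y // [hi hj].
    by have : (F i `&` F j) (chi t *: x0 + y) by []; rewrite h.
  + by apply: bigcupT_measurable => n; exact: shift_set_measurable.
- rewrite (eq_integral (cst 1%E)) => [|t _].
    by rewrite integral_cst//= lebesgue_measure_itv /= lte_fin ltr01 oppr0 adde0 mule1.
  by rewrite /= -(probability_setT m).
Qed.

End Translate.

(** The definition of [steinhaus] speaks of a given measure; here one is built for every finite
    family, adding one independent rotated vector at a time. *)
Lemma steinhaus_law (n : nat) (x : 'I_n -> X) : exists m : Pmeas X, forall A : set (BX X),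
  measurable A ->
  m A = iter_int n (fun th => (\1_A (\sum_(j < n) chi (th j) *: x j : BX X))%:E).
Proof.
elim: n x => [|n IH] x.
  exists (dirac (0 : BX X)) => A mA /=.
  by rewrite diracE big_ord0 /= indicE.
have [m hm] := IH (fun j => x (lift ord0 j)).
have [m' hm'] := translate_law (x ord0) m.
exists m' => A mA; rewrite hm' /=; apply: eq_integral => t _.
rewrite hm; last exact: shift_set_measurable.
congr iter_int; apply/funext => th; congr EFin.
by rewrite !indicE big_ord_recl /=; congr ((nat_of_bool _)%:R).
Qed.

End SteinhausLaw.

(** * Binary digits of a uniform variable *)

Section FinitePartition.
Context (R : realType) (dT : measure_display) (T : measurableType dT).
Variables (mu : {measure set T -> \bar R}) (D : set T) (F : finType) (Z : T -> F).
Hypothesis mZ : forall f, measurable (D `&` [set t | Z t = f]).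

Let consE f (s : seq F) : D `&` [set t | Z t \in f :: s] =
  (D `&` [set t | Z t = f]) `|` (D `&` [set t | Z t \in s]).
Proof.
rewrite -setIUr; congr (_ `&` _); apply/seteqP; split=> t /=; rewrite inE.
  by case/orP=> [/eqP|]; [left|right].
by case=> [->|->]; rewrite ?eqxx ?orbT.
Qed.

Let consD f (s : seq F) : f \notin s ->
  (D `&` [set t | Z t = f]) `&` (D `&` [set t | Z t \in s]) = set0.
Proof.
move=> fs; apply/seteqP; split=> t //= [[_ ->] [_ fs']].
by rewrite fs' in fs.
Qed.

Let m_in (s : seq F) : measurable (D `&` [set t | Z t \in s]).
Proof.
elim: s => [|f s IH]; last by rewrite consE; exact: measurableU.
by rewrite (_ : [set _ | _] = set0) ?setI0//; apply/seteqP; split.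
Qed.

Let mu_in (s : seq F) : uniq s ->
  mu (D `&` [set t | Z t \in s]) = (\sum_(f <- s) mu (D `&` [set t | Z t = f]))%E.
Proof.
elim: s => [_|f s IH /= /andP[fs us]].
  by rewrite big_nil (_ : [set _ | _] = set0) ?setI0 ?measure0//; apply/seteqP; split.
rewrite consE measureU//; last exact: consD.
by rewrite big_cons; congr (_ + _)%E; exact: IH.
Qed.

Let predE (h : pred F) : D `&` [set t | h (Z t)] = D `&` [set t | Z t \in enum h].
Proof. by congr (_ `&` _); apply/seteqP; split=> t /=; rewrite mem_enum. Qed.

Lemma finite_partition_measurable (h : pred F) : measurable (D `&` [set t | h (Z t)]).
Proof. by rewrite predE. Qed.

Lemma finite_partition_measure (h : pred F) :
  mu (D `&` [set t | h (Z t)]) = (\sum_(f | h f) mu (D `&` [set t | Z t = f]))%E.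
Proof. by rewrite predE mu_in ?enum_uniq// big_enum. Qed.

Lemma finite_partition_integral_le (g : T -> \bar R) (H : F -> R) :
  measurable D -> measurable_fun D g -> (forall t, D t -> (0 <= g t)%E) ->
  (forall t, D t -> (g t <= (H (Z t))%:E)%E) ->
  (\int[mu]_(t in D) g t <= \sum_f (H f)%:E * mu (D `&` [set t | Z t = f]))%E.
Proof.
move=> mD mg g0 gH.
have key (s : seq F) : uniq s -> (\int[mu]_(t in D `&` [set t | Z t \in s]) g t <=
    \sum_(f <- s) (H f)%:E * mu (D `&` [set t | Z t = f]))%E.
  elim: s => [_|f s IH /= /andP[fs us]].
    rewrite big_nil (_ : [set _ | _] = set0) ?setI0 ?integral_set0//.
    by apply/seteqP; split.
  rewrite consE ge0_integral_setU//; last 3 first.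
  - by apply: measurable_funS mg => //; rewrite -setIUr; exact: subIsetl.
  - by move=> t [] [] + _; exact: g0.
  - by apply/disj_set2P; exact: consD.
  rewrite big_cons leeD ?IH// -integral_cst//.
  apply: ge0_le_integral => //.
  - by move=> t [/g0].
  - by apply: measurable_funS mg => //; exact: subIsetl.
  - by move=> t [Dt <-]; exact: gH.
have := key (index_enum F) (index_enum_uniq _); rewrite (_ : D `&` [set t | _] = D)//.
by apply/setIidPl => t _ /=; rewrite mem_index_enum.
Qed.

End FinitePartition.

Section BinaryDigits.
Variable R : realType.
Implicit Types (t : R) (q : nat).
Local Notation mu := (@lebesgue_measure R).

(** For [t] in [[0, 1[], [lod q t] is [t] rounded down to a multiple of [2 ^- q], found greedily;
    digit [r], counted from [0], has weight [2 ^- r.+1]. *)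
Fixpoint lod q t : R :=
  if q is q'.+1 then lod q' t + (lod q' t + 2 ^- q'.+1 <= t)%R%:R * 2 ^- q'.+1 else 0.

Definition dig q t : bool := lod q t + 2 ^- q.+1 <= t.

Definition loB q (b : {ffun 'I_q -> bool}) : R := \sum_(r < q) (b r)%:R * 2 ^- r.+1.

Let half q : 2 ^- q = 2 ^- q.+1 + 2 ^- q.+1 :> R.
Proof. by rewrite exprS invfM [2^-1 * _]mulrC -splitr. Qed.

Let half_gt0 q : 0 < 2 ^- q :> R.
Proof. by rewrite invr_gt0 exprn_gt0. Qed.

Lemma lod_sum q t : lod q t = \sum_(r < q) (dig r t)%:R * 2 ^- r.+1.
Proof. by elim: q => [|q IH]; rewrite ?big_ord0// big_ord_recr /= IH /dig IH. Qed.

Lemma lod_itv q t : 0 <= t < 1 -> lod q t <= t < lod q t + 2 ^- q.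
Proof.
move=> t01; elim: q => [|q IH] /=; first by rewrite expr0 invr1 add0r.
have := half q; have := half_gt0 q.+1; move: IH.
case: (leP (lod q t + 2 ^- q.+1) t); rewrite ?mul1r ?mul0r; move: (2 ^- q.+1) (2 ^- q) => a b; lra.
Qed.

Lemma bits_itv q (b : 'I_q -> bool) : 0 <= \sum_(r < q) (b r)%:R * 2 ^- r.+1 :> R /\
  \sum_(r < q) (b r)%:R * 2 ^- r.+1 + 2 ^- q <= 1 :> R.
Proof.
elim: q b => [|q IH] b; first by rewrite big_ord0 expr0 invr1 add0r.
rewrite big_ord_recr /=; have [] := IH (fun r => b (widen_ord (leqnSn q) r)).
have := half q; have := half_gt0 q.+1; move: (2 ^- q.+1) (2 ^- q) => a c.
by case: (b ord_max); rewrite ?mul1r ?mul0r; lra.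
Qed.

Lemma digits_of_itv q (b : nat -> bool) t :
  \sum_(r < q) (b r)%:R * 2 ^- r.+1 <= t < \sum_(r < q) (b r)%:R * 2 ^- r.+1 + 2 ^- q ->
  forall r, (r < q)%N -> dig r t = b r.
Proof.
elim: q => [//|q IH]; rewrite big_ord_recr /= => h.
have hq := half q; have hq0 := half_gt0 q.+1.
set a := 2 ^- q.+1 in h hq hq0; set c := 2 ^- q in hq IH.
have {}IH : forall r, (r < q)%N -> dig r t = b r.
  by apply: IH; move: h; case: (b q); rewrite ?mul1r ?mul0r; lra.
move=> r; rewrite ltnS leq_eqVlt => /orP[/eqP->|/IH//].
have e : lod q t = \sum_(r < q) (b r)%:R * 2 ^- r.+1.
  by rewrite lod_sum; apply: eq_bigr => i _; rewrite IH.
rewrite /dig e -/a; move: h; case: (b q); rewrite ?mul1r ?mul0r => h; last first.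
  by apply/negbTE; rewrite -ltNge; lra.
lra.
Qed.

Definition bitsq q t : {ffun 'I_q -> bool} := [ffun r : 'I_q => dig r t].

Lemma loB_bitsq q t : loB (bitsq q t) = lod q t.
Proof. by rewrite lod_sum; apply: eq_bigr => r _; rewrite ffunE. Qed.

Lemma cylinderE q (b : {ffun 'I_q -> bool}) :
  `[0%R, 1%R[%classic `&` [set t | bitsq q t = b] = `[loB b, loB b + 2 ^- q[%classic.
Proof.
have [b0 b1] := bits_itv b.
apply/seteqP; split=> [t /= [t01 <-]|t /= tb].
  by rewrite in_itv /= loB_bitsq lod_itv//; move: t01; rewrite in_itv.
move: tb; rewrite in_itv /= => tb; split.
  by rewrite in_itv /= /loB in tb *; lra.
apply/ffunP => r; rewrite ffunE.
pose b' i := if insub i is Some j then b j else false.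
have e : \sum_(r < q) (b' r)%:R * 2 ^- r.+1 = loB b.
  by apply: eq_bigr => i _; rewrite /b' valK.
by rewrite (@digits_of_itv q b')// ?e// /b' valK.
Qed.

Lemma cylinder_measurable q (b : {ffun 'I_q -> bool}) :
  measurable (`[0%R, 1%R[%classic `&` [set t | bitsq q t = b]).
Proof. by rewrite cylinderE. Qed.

Lemma cylinder_measure q (b : {ffun 'I_q -> bool}) :
  mu (`[0%R, 1%R[%classic `&` [set t | bitsq q t = b]) = (2 ^- q)%:E.
Proof.
rewrite cylinderE lebesgue_measure_itv /= lte_fin ltrDl half_gt0.
by rewrite -EFinB addrAC subrr add0r.
Qed.

(** * Independence of the digits at distinct positions *)

Section Subfamily.
Variables (I : finType) (code : I -> nat).
Hypothesis code_inj : injective code.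

Definition bitsI t : {ffun I -> bool} := [ffun i => dig (code i) t].

Let q := (\max_i code i).+1.
Let code_lt i : (code i < q)%N.
Proof. by rewrite ltnS leq_bigmax. Qed.
Let codeO i : 'I_q := Ordinal (code_lt i).
Let compat (g : {ffun I -> bool}) (b : {ffun 'I_q -> bool}) := [forall i, b (codeO i) == g i].

Let setE g : [set t | bitsI t = g] = [set t | compat g (bitsq q t)].
Proof.
apply/seteqP; split=> t /=.
  by move=> <-; apply/forallP => i; rewrite !ffunE.
by move=> /forallP h; apply/ffunP => i; have /eqP := h i; rewrite !ffunE.
Qed.

Lemma bitsI_measurable g : measurable (`[0%R, 1%R[%classic `&` [set t | bitsI t = g]).
Proof.
by rewrite setE; apply: finite_partition_measurable => b; exact: cylinder_measurable.
Qed.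

Lemma bitsI_measure g :
  mu (`[0%R, 1%R[%classic `&` [set t | bitsI t = g]) = (2 ^- #|I|)%:E.
Proof.
rewrite setE (finite_partition_measure mu (@cylinder_measurable q)).
rewrite (eq_bigr (fun=> (2 ^- q)%:E)); last by move=> b _; exact: cylinder_measure.
rewrite sumEFin; congr EFin.
(* Compatible digit strings are counted by a product over positions: a prescribed position
   contributes [1/2] and a free one [1/2 + 1/2]. *)
pose F (r : 'I_q) (x : bool) : R :=
  2^-1 * ([forall i, (codeO i == r) ==> (x == g i)])%:R.
have e (b : {ffun 'I_q -> bool}) : \prod_r F r (b r) = if compat g b then 2 ^- q else 0.
  case: ifPn => [/forallP cb|/forallPn[i bi]].
    rewrite (eq_bigr (fun=> 2^-1)) ?prodr_const ?card_ord ?exprVn// => r _.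
    rewrite /F (_ : [forall _, _] = true) ?mulr1//.
    by apply/forallP => i; apply/implyP => /eqP <-; exact: cb.
  apply/eqP; rewrite prodf_seq_eq0; apply/hasP; exists (codeO i); first exact: mem_index_enum.
  rewrite /F mulf_eq0 pnatr_eq0 eqb0; apply/orP; right.
  by apply/forallPn; exists i; rewrite eqxx.
rewrite big_mkcond /=; under eq_bigr do rewrite -e.
rewrite -(bigA_distr_bigA F) /=.
have cinj : injective codeO by move=> i j [] /code_inj.
have s (r : 'I_q) : \sum_x F r x = if r \in codom codeO then 2^-1 else 1.
  rewrite big_bool /F /=; case: ifPn => [/codomP[i ->]|hr].
    have E x : [forall i0, (codeO i0 == codeO i) ==> (x == g i0)] = (x == g i).
      apply/forallP/eqP => [/(_ i)|-> j]; first by rewrite eqxx => /eqP.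
      by apply/implyP => /eqP/cinj ->.
    by rewrite !E; case: (g i); rewrite /= ?mulr0 ?mulr1 ?addr0 ?add0r.
  have E x : [forall i, (codeO i == r) ==> (x == g i)] = true.
    by apply/forallP => i; apply/implyP => /eqP h; rewrite -h codom_f in hr.
  by rewrite !E mulr1 [RHS]splitr mul1r.
under eq_bigr do rewrite s.
by rewrite -big_mkcond /= prodr_const (card_codom cinj) exprVn.
Qed.

End Subfamily.

Section Grid.
Variables (J q : nat).

Definition grid := {ffun 'I_J -> {ffun 'I_q -> bool}}.

(** Pairing positions by [pickle] gives different angles disjoint sets of digits of the same [t],
    hence independence; enlarging [J] or [q] leaves digits already read unchanged. *)
Definition gbits t : grid :=
  [ffun j : 'I_J => [ffun r : 'I_q => dig (pickle (j : nat, r : nat)) t]].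

Let code (jr : 'I_J * 'I_q) : nat := pickle (jr.1 : nat, jr.2 : nat).
Let code_inj : injective code.
Proof.
move=> [i r] [j s] /(pcan_inj pickleK) [] /= h1 h2.
by congr (_, _); apply: val_inj.
Qed.

Let setE (g : grid) : [set t | gbits t = g] = [set t | bitsI code t = [ffun jr => g jr.1 jr.2]].
Proof.
apply/seteqP; split=> t /= [].
  by move=> <-; apply/ffunP => jr; rewrite !ffunE.
move=> h; apply/ffunP => j; apply/ffunP => r.
by have /ffunP/(_ (j, r)) := h; rewrite !ffunE.
Qed.

Lemma gbits_measurable (h : pred grid) : measurable (`[0%R, 1%R[%classic `&` [set t | h (gbits t)]).
Proof.
by apply: finite_partition_measurable => g; rewrite setE; exact: bitsI_measurable.
Qed.

Lemma gbits_measure (h : pred grid) :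
  mu (`[0%R, 1%R[%classic `&` [set t | h (gbits t)]) = (#|h|%:R * 2 ^- (J * q))%:E.
Proof.
rewrite (finite_partition_measure mu) => [|g]; last first.
  by rewrite setE; exact: bitsI_measurable.
rewrite (eq_bigr (fun=> (2 ^- (J * q))%:E)) => [|g _].
  by rewrite sumEFin sumr_const mulr_natl.
by rewrite setE [LHS](bitsI_measure code_inj) card_prod !card_ord.
Qed.

End Grid.

Lemma loB_in01 q (b : {ffun 'I_q -> bool}) : 0 <= loB b < 1.
Proof. by have [] := bits_itv b; have := half_gt0 q; rewrite /loB => *; lra. Qed.

Definition bsum (b : nat -> bool) n : R := \sum_(r < n) (b r)%:R * 2 ^- r.+1.

Lemma partial_sum_refine (b : nat -> bool) q q' : (q <= q')%N ->
  0 <= bsum b q' - bsum b q < 2 ^- q.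
Proof.
move=> qq'; set s := bsum b; suff : 0 <= s q' - s q <= 2 ^- q - 2 ^- q' by have := half_gt0 q'; lra.
rewrite -(subnKC qq'); elim: (q' - q)%N => [|k IH]; first by rewrite addn0 !subrr lexx.
have -> : s (q + k.+1)%N = s (q + k)%N + (b (q + k)%N)%:R * 2 ^- (q + k).+1.
  by rewrite /s /bsum addnS big_ord_recr.
rewrite addnS; move: IH; have := half (q + k)%N; have := half_gt0 (q + k).+1.
move: (2 ^- (q + k).+1) (2 ^- (q + k)) (2 ^- q) => a c d.
by case: (b _); rewrite ?mul1r ?mul0r; lra.
Qed.

End BinaryDigits.

(** * Steinhaus sums with dyadic angles *)

Section GridFamily.
Variables (R : realType) (X : normedModType R[i]).
Local Notation mu := (@lebesgue_measure R).

Definition gval (J q : nat) (x : 'I_J -> X) (g : grid J q) : X :=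
  \sum_(j < J) chi (loB R (g j)) *: x j.

Definition flipB q (b : {ffun 'I_q.+1 -> bool}) : {ffun 'I_q.+1 -> bool} :=
  [ffun r => if r == ord0 then ~~ b r else b r].

Lemma flipBK q : involutive (@flipB q).
Proof. by move=> b; apply/ffunP => r; rewrite !ffunE; case: eqP; rewrite ?negbK. Qed.

(* The leading binary digit of the angle carries the sign. *)
Lemma chi_flipB q (b : {ffun 'I_q.+1 -> bool}) : chi (loB R (flipB b)) = - chi (loB R b).
Proof.
rewrite /loB !big_ord_recl !ffunE eqxx expr1 /=.
have -> : \sum_(i < q) (flipB b (lift ord0 i))%:R * 2 ^- (bump 0 i).+1 =
          \sum_(i < q) (b (lift ord0 i))%:R * 2 ^- (bump 0 i).+1 :> R.
  by apply: eq_bigr => i _; rewrite ffunE.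
by case: (b ord0); rewrite /= mul0r mul1r add0r chiD chi_half mulN1r ?opprK.
Qed.

(** Flipping leading digits permutes the grid and changes the signs of the corresponding terms.
    Averaging over all flips brings in the random signs of the type inequality; [q.+1] ensures that
    a leading digit exists. *)
Lemma type_grid (p : R) : has_type X p -> exists2 K : R, 0 <= K &
  forall (J q : nat) (x : 'I_J -> X),
    \sum_(g : grid J q.+1) nrm (gval x g) `^ p <= 2 ^+ (J * q.+1) * (K * \sum_j nrm (x j) `^ p).
Proof.
move=> [C' hC']; pose K := Num.max C' 0; exists K; first by rewrite le_max lexx orbT.
move=> J q x; pose E := {ffun 'I_J -> bool}.
pose flip (eps : E) (g : grid J q.+1) : grid J q.+1 :=
  [ffun j => if eps j then g j else flipB (g j)].
have flipK eps : involutive (flip eps).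
  by move=> g; apply/ffunP => j; rewrite !ffunE; case: (eps j) => //; rewrite flipBK.
have flipE eps : \sum_(g : grid J q.+1) nrm (gval x (flip eps g)) `^ p =
                 \sum_(g : grid J q.+1) nrm (gval x g) `^ p.
  by rewrite [RHS](reindex_inj (inv_inj (flipK eps))).
have S0 : 0 <= \sum_j nrm (x j) `^ p by apply: sumr_ge0 => j _; exact: powR_ge0.
have avg (g : grid J q.+1) :
    (2 ^+ J)^-1 * \sum_(eps : E) nrm (gval x (flip eps g)) `^ p <= K * \sum_j nrm (x j) `^ p.
  have := hC' J (fun j => chi (loB R (g j)) *: x j).
  under [X in _ <= _ * X]eq_bigr do rewrite nrmZ cabs_chi mul1r.
  move=> h; apply: (@le_trans _ _ (C' * \sum_j nrm (x j) `^ p)); last first.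
    by rewrite ler_wpM2r// le_max lexx.
  apply: le_trans h; rewrite le_eqVlt; apply/orP; left; apply/eqP; congr (_ * _).
  apply: eq_bigr => eps _; congr (nrm _ `^ _); apply: eq_bigr => j _.
  by rewrite ffunE; case: (eps j) => //; rewrite chi_flipB scaleNr.
have -> : \sum_(g : grid J q.+1) nrm (gval x g) `^ p =
    \sum_(g : grid J q.+1) (2 ^+ J)^-1 * \sum_(eps : E) nrm (gval x (flip eps g)) `^ p.
  rewrite -mulr_sumr exchange_big /= (eq_bigr _ (fun eps _ => flipE eps)) sumr_const.
  rewrite card_ffun card_bool card_ord -[X in _ * X]mulr_natl natrX.
  by rewrite mulKf// expf_neq0 ?pnatr_eq0.
apply: (@le_trans _ _ (\sum_(g : grid J q.+1) K * \sum_j nrm (x j) `^ p)).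
  by apply: ler_sum => g _; exact: avg.
rewrite sumr_const card_ffun card_ffun card_bool !card_ord -[leLHS]mulr_natl.
by rewrite -expnM mulnC natrX.
Qed.

(** Markov's inequality for the [p]-th moment, in counting form. *)
Lemma grid_markov (p K : R) (J q : nat) (x : 'I_J -> X) (e : R) : 0 < e ->
  0 < p ->
  \sum_(g : grid J q) nrm (gval x g) `^ p <= 2 ^+ (J * q) * (K * \sum_j nrm (x j) `^ p) ->
  (mu (`[0%R, 1%R[%classic `&` [set t | (e <= nrm (gval x (gbits J q t)))%R]) <=
    (K * (\sum_j nrm (x j) `^ p) / e `^ p)%:E)%E.
Proof.
move=> e0 p0 h; rewrite (gbits_measure R (fun g : grid J q => e <= nrm (gval x g))).
rewrite lee_fin ler_pdivlMr ?powR_gt0// mulrAC ler_pdivrMr ?exprn_gt0// mulrC.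
rewrite [leRHS]mulrC mulrC; apply: le_trans h.
rewrite -sum1_card natr_sum mulr_suml [leRHS](bigID (fun g : grid J q => e <= nrm (gval x g))) /=.
apply: (@le_trans _ _ (\sum_(g : grid J q | e <= nrm (gval x g)) nrm (gval x g) `^ p)); last first.
  by rewrite lerDl; apply: sumr_ge0 => g _; exact: powR_ge0.
apply: ler_sum => g eg; rewrite mul1r ge0_ler_powR ?nnegrE ?nrm_ge0 ?(ltW p0) ?(ltW e0)//.
Qed.

Definition gcons n q (b : {ffun 'I_q -> bool}) (g : grid n q) : grid n.+1 q :=
  [ffun j => if unlift ord0 j is Some j' then g j' else b].

Lemma sum_gcons n q (F : grid n.+1 q -> R) :
  \sum_(g : grid n.+1 q) F g = \sum_b \sum_(g : grid n q) F (gcons b g).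
Proof.
rewrite pair_big /= (reindex (fun bg : {ffun 'I_q -> bool} * grid n q => gcons bg.1 bg.2)) //=.
exists (fun g : grid n.+1 q => (g ord0, [ffun j => g (lift ord0 j)])) => [[b g] _|g _] /=.
  congr (_, _); first by rewrite ffunE unlift_none.
  by apply/ffunP => j; rewrite !ffunE liftK.
apply/ffunP => j; rewrite !ffunE; case: unliftP => [j' ->|->//].
by rewrite ffunE.
Qed.

Lemma gval_gcons n q (x : 'I_n.+1 -> X) b (g : grid n q) :
  gval x (gcons b g) = chi (loB R b) *: x ord0 + gval (fun j => x (lift ord0 j)) g.
Proof.
rewrite /gval big_ord_recl ffunE unlift_none; congr (_ + _).
by apply: eq_bigr => j _; rewrite ffunE liftK.
Qed.

Variable d : nat -> X.
Hypothesis hd : forall x e, 0 < e -> exists k, nrm (x - d k) < e.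

(** Rounding every angle to [q] digits moves the sum by less than [e]. The induction integrates the
    first angle over dyadic intervals and charges [kappa * nrm (x ord0)] to the allowance [e]. *)
Lemma steinhaus_grid (q : nat) (kappa : R) : 0 <= kappa ->
  (forall t, 0 <= t < 1 -> cabs (chi t - chi (lod q t)) <= kappa) ->
  forall (n : nat) (x : 'I_n -> X) (m : Pmeas X) (e : R),
  (forall A : set (BX X), measurable A ->
    m A = iter_int n (fun th => (\1_A (\sum_(j < n) chi (th j) *: x j : BX X))%:E)) ->
  kappa * \sum_j nrm (x j) < e -> forall A : set (BX X), measurable A ->
  (m A <= (\sum_(g : grid n q) (`[< enl A e (gval x g) >])%:R * 2 ^- (n * q))%:E)%E.
Proof.
move=> k0 hk; elim=> [|n IH] x m e hm he A mA.
  rewrite hm//= big_ord0 indicE lee_fin mul0n expr0 invr1.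
  under eq_bigr do rewrite mulr1.
  rewrite big_ord0 mulr0 in he.
  have [A0|A0] := boolP (0 \in A); last by apply: sumr_ge0 => g _; rewrite ler0n.
  have g0 : grid 0 q by exact: [ffun=> [ffun=> false]].
  rewrite (bigD1 g0)//= -[leLHS]addr0 lerD//; last by apply: sumr_ge0 => g _; rewrite ler0n.
  rewrite (_ : `[< _ >] = true)//; apply/asboolP; exists 0; first exact: set_mem.
  by rewrite /gval big_ord0 subrr nrm0.
have [m' hm'] := steinhaus_law hd (fun j : 'I_n => x (lift ord0 j)).
have mE : m A = (\int[mu]_(t in `[0%R, 1%R]) m' (shift_set (x ord0) A t))%E.
  rewrite hm//=; apply: eq_integral => t _.
  rewrite hm'; last exact: (shift_set_measurable hd).
  congr iter_int; apply/funext => th; congr EFin.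
  by rewrite !indicE big_ord_recl /=; congr ((nat_of_bool _)%:R).
have mf : measurable_fun (`[0%R, 1%R[%classic : set R) (fun t : R => m' (shift_set (x ord0) A t)).
  exact: (measurable_prob_shift hd).
(* The endpoint [1] is dropped because the digit cylinders partition [[0, 1[]. *)
rewrite mE -integral_itv_bndo_bndc//.
pose H (b : {ffun 'I_q -> bool}) : R :=
  \sum_(g : grid n q) (`[< enl A e (chi (loB R b) *: x ord0 + gval (fun j => x (lift ord0 j)) g) >])%:R
    * 2 ^- (n * q).
apply: (@le_trans _ _ (\sum_b (H b)%:E * mu (`[0%R, 1%R[%classic `&` [set t | bitsq q t = b]))%E).
  apply: finite_partition_integral_le => // [b|t]; first exact: cylinder_measurable.
  rewrite /= in_itv /= => t01; pose e' := e - kappa * nrm (x ord0).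
  have e'0 : kappa * \sum_j nrm (x (lift ord0 j)) < e'.
    by move: he; rewrite big_ord_recl mulrDr /e' => ?; lra.
  apply: (le_trans (IH _ _ _ hm' e'0 _ (shift_set_measurable hd _ _ mA))).
  rewrite lee_fin /H; apply: ler_sum => g _; rewrite ler_wpM2r ?invr_ge0 ?exprn_ge0// ler_nat.
  case: asboolP => // -[y Ay gy]; rewrite (_ : `[< _ >] = true)//; apply/asboolP.
  exists (chi t *: x ord0 + y) => //; rewrite opprD addrACA -scalerBl loB_bitsq.
  apply: (le_lt_trans (nrmD _ _)); rewrite nrmZ cabsC.
  have := ler_wpM2r (nrm_ge0 (x ord0)) (hk t t01); move: gy; rewrite /e'; lra.
rewrite (eq_bigr (fun b => (H b * 2 ^- q)%:E)); last first.
  by move=> b _; rewrite [X in (_ * X)%E](cylinder_measure R b) EFinM.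
rewrite sumEFin lee_fin sum_gcons; apply: ler_sum => b _.
rewrite /H mulr_suml; apply: ler_sum => g _; rewrite gval_gcons.
by rewrite -mulrA -invfM -exprD mulSnr.
Qed.

End GridFamily.

(** * The limit law *)

Section LimitLaw.
Variables (R : realType) (X : completeNormedModType R[i]).
Local Notation mu := (@lebesgue_measure R).
Local Notation D := (`[0%R, 1%R[%classic : set R).

Lemma nrm_cauchy_cvg (u : nat -> X) :
  (forall e : R, 0 < e -> exists N, forall n, (N <= n)%N -> nrm (u N - u n) < e) ->
  exists l, forall e : R, 0 < e -> exists N, forall n, (N <= n)%N -> nrm (l - u n) < e.
Proof.
move=> hu; have cu : cauchy (u @ \oo).
  apply: cauchy_exP => e e0.
  have eE : e = (complex.Re e)%:C%C.
    by move: e0; case: (e) => a b; rewrite ltcE /= => /andP[/eqP-> _].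
  have [|N hN] := hu (complex.Re e); first by rewrite -ltcR -eE.
  exists (u N); exists N => // n /= Nn.
  by rewrite -ball_normE /ball_ /= nrmE eE ltcR hN.
have /cvg_ex[l ul] : cvg (u @ \oo) by exact: cauchy_cvg.
exists l => e e0.
have [|N _ hN] := ul [set y | nrm (l - y) < e]; first by apply/nbhs_nrmP; exists e.
by exists N => n /hN.
Qed.

Variables (Z : nat -> R -> X) (eps : nat -> R).
Hypothesis mZ : forall n (A : set X), measurable (D `&` [set t | A (Z n t)]).
Hypothesis eps0 : forall n, 0 < eps n.
Hypothesis epsS : forall n, eps n.+1 <= eps n / 2.

Let B n : set R := D `&` [set t | eps n <= nrm (Z n t - Z n.+1 t)].
Hypothesis mB : forall n, measurable (B n).
Hypothesis muB : forall n, (mu (B n) <= (eps n)%:E)%E.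

Lemma eps_cvg0 (e : R) : 0 < e -> exists N, forall n, (N <= n)%N -> eps n < e.
Proof.
move=> e0; have bnd n : eps n * n.+1%:R <= eps 0%N.
  elim: n => [|n IH]; first by rewrite mulr1.
  apply: le_trans IH; apply: (le_trans (ler_wpM2r (ler0n R _) (epsS n))).
  have := mulr_ge0 (ltW (eps0 n)) (ler0n R n); rewrite -[n.+2%:R]natr1 -[n.+1%:R]natr1.
  move: (n%:R) (eps n) => a b; lra.
exists (Num.truncn (eps 0%N / e)) => n Nn.
have n0 : 0 < n.+1%:R :> R by [].
rewrite -(ltr_pM2r n0) (le_lt_trans (bnd n))// mulrC -ltr_pdivrMr//.
by rewrite (lt_le_trans (truncnS_gt _))// ler_nat ltnS.
Qed.

(** The set where some increment from stage [n] on is too large; halving of [eps] bounds its mass by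
    a geometric series, as in the Borel-Cantelli lemma. *)
Let U n : set R := \bigcup_k B (n + k)%N.

Let mU n : measurable (U n).
Proof. by apply: bigcupT_measurable => k; exact: mB. Qed.

Let muU n : (mu (U n) <= (2 * eps n)%:E)%E.
Proof.
pose V K : set R := \big[setU/set0]_(k < K) B (n + k)%N.
have mV K : measurable (V K) by apply: bigsetU_measurable => k _; exact: mB.
have UE : U n = \bigcup_K V K.
  apply/seteqP; split=> t [k _]; last first.
    by rewrite /V -(bigcup_mkord k (fun k => B (n + k)%N)) => -[j _ Bj]; exists j.
  by move=> Bk; exists k.+1 => //; rewrite /V -(bigcup_mkord _ (fun k => B (n + k)%N)); exists k => /=.
have : (mu \o V) @ \oo --> mu (\bigcup_K V K).
  apply: nondecreasing_cvg_mu => //; first by rewrite -UE; exact: mU.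
  move=> a b ab; apply/subsetPset; rewrite /V.
  rewrite -(bigcup_mkord a (fun k => B (n + k)%N)) -(bigcup_mkord b (fun k => B (n + k)%N)).
  by move=> t [k /= ka Bk]; exists k => //=; exact: leq_trans ab.
rewrite -UE; apply: cvge_le; apply: nearW => K /=.
(* The bound telescopes, since [eps k <= 2 * (eps k - eps k.+1)]. *)
suff h : (mu (V K) <= (2 * (eps n - eps (n + K)%N))%:E)%E.
  by apply: (le_trans h); rewrite lee_fin; have := eps0 (n + K)%N; lra.
elim: K => [|K IH]; first by rewrite /V big_ord0 measure0 addn0 subrr mulr0.
have -> : V K.+1 = V K `|` B (n + K)%N by rewrite /V big_ord_recr.
have h := @measureU2 _ _ _ mu _ _ (mV K) (mB (n + K)%N); apply: (le_trans h).
apply: (le_trans (leeD IH (muB (n + K)%N))); rewrite -EFinD lee_fin addnS.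
by have := epsS (n + K)%N; lra.
Qed.

Let U_decr n k : (n <= k)%N -> U k `<=` U n.
Proof. by move=> nk t [j _ Bt]; exists (k - n + j)%N => //; rewrite addnA subnKC. Qed.

Let tele t n : D t -> ~ U n t -> forall k j, (n <= k)%N ->
  nrm (Z k t - Z (k + j)%N t) <= 2 * (eps k - eps (k + j)%N).
Proof.
move=> Dt nU k + nk; elim=> [|j IH]; first by rewrite addn0 !subrr nrm0 mulr0.
apply: (le_trans (nrm_tri _ (Z (k + j)%N t) _)).
have : nrm (Z (k + j)%N t - Z (k + j.+1)%N t) <= eps (k + j)%N.
  rewrite leNgt; apply/negP => h; apply: nU; exists (k + j - n)%N => //.
  by rewrite subnKC ?(leq_trans nk) ?leq_addr//; split => //=; rewrite -addnS ltW.
by have := epsS (k + j)%N; rewrite addnS; lra.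
Qed.

(** The second clause prescribes the value on the null set where increments are too large infinitely
    often; otherwise the choice there would be arbitrary and measurability could fail. *)
Let limit_exists t : exists s : X,
  (forall n, D t -> ~ U n t -> nrm (s - Z n t) <= 2 * eps n) /\
  ((forall n, U n t) -> s = 0).
Proof.
have [[Dt [n0 nU]]|h] := pselect (D t /\ exists n, ~ U n t); last first.
  exists 0; split=> // n Dt nU; exfalso; apply: h; split => //; by exists n.
have [|s hs] := @nrm_cauchy_cvg (fun n => Z n t).
  move=> e e0; have [N hN] := @eps_cvg0 (e / 2) (divr_gt0 e0 (ltr0n _ 2)).
  exists (maxn N n0) => n Nn; rewrite -(subnKC Nn).
  apply: (le_lt_trans (tele Dt nU _ (leq_maxr _ _))).
  have := hN _ (leq_maxl N n0); have := eps0 (maxn N n0 + (n - maxn N n0))%N.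
  lra.
exists s; split; last by move=> /(_ n0).
move=> n _ nUn; apply/ler_addgt0Pr => e e0; have [N hN] := hs e e0.
have := tele Dt nUn N (leqnn n); have := hN (n + N)%N (leq_addl _ _).
have := nrm_tri s (Z (n + N)%N t) (Z n t); rewrite [nrm (Z (n + N)%N t - _)]nrm_sub.
by have := eps0 (n + N)%N; lra.
Qed.

Let S : R -> X := projT1 (choice limit_exists).
Let S_close t n : D t -> ~ U n t -> nrm (S t - Z n t) <= 2 * eps n.
Proof. by move=> Dt; have [h _] := projT2 (choice limit_exists) t; exact: h. Qed.
Let S_zero t : (forall n, U n t) -> S t = 0.
Proof. by have [_ h] := projT2 (choice limit_exists) t; exact: h. Qed.

(** Where the increments are eventually small, the limit lies in the open set [W] exactly when, for
    some [k], all [Z] from some stage on lie in [inner W k.+1%:R^-1]. Elsewhere in [D] it is [0]. *)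
Let S_measurable : measurable_fun D (S : R -> BX X).
Proof.
apply: (@measurability _ _ _ (BX X) _ _ (@open X)) => // _ [W oW <-].
pose E := \bigcup_n (~` U n).
pose L := \bigcup_k \bigcup_N \bigcap_m
   (D `&` [set t | inner W k.+1%:R^-1 (Z (N + m)%N t)]).
have mE : measurable E by apply: bigcupT_measurable => n; apply: measurableC; exact: mU.
have mL : measurable L.
  apply: bigcupT_measurable => k; apply: bigcupT_measurable => N.
  by apply: bigcapT_measurable => m; exact: mZ.
have -> : D `&` (S @^-1` W) = (D `&` [set t | W 0] `&` ~` E) `|` (E `&` L).
  apply/seteqP; split=> t /=.
    move=> [Dt WS]; have [Et|nE] := pselect (E t); last first.
      left; split => //; split => //; rewrite -(@S_zero t)// => n.
      by apply: contrapT => nU; apply: nE; exists n.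
    right; split => //; have [n _ nU] := Et.
    move: oW => /open_nrmP/(_ _ WS)[e e0 he].
    exists (Num.truncn (e / 2)^-1) => //.
    have ke : (Num.truncn (e / 2)^-1).+1%:R^-1 < e / 2.
      by rewrite invf_plt ?posrE ?divr_gt0// truncnS_gt.
    have [N hN] := @eps_cvg0 (e / 4) (divr_gt0 e0 (ltr0n _ 4)).
    exists (maxn N n) => // m _; split=> // z hz; apply: he.
    set k := (maxn N n + m)%N.
    have kN : (N <= k)%N by rewrite (leq_trans (leq_maxl N n))// leq_addr.
    have kn : (n <= k)%N by rewrite (leq_trans (leq_maxr N n))// leq_addr.
    have nUk : ~ U k t by move/(U_decr kn).
    rewrite opprD addrA (le_lt_trans (nrmD _ _))// nrmN [ltRHS]splitr ler_ltD//.
      apply: (le_trans (S_close Dt nUk)); have := hN k kN.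
      by move: (eps k) => a; lra.
    exact: lt_trans ke.
  case=> [[[Dt W0] nE]|[[n _ nU] [k _ [N _ hL]]]].
    split=> //; rewrite S_zero// => n; apply: contrapT => nU; apply: nE.
    by exists n.
  have Dt : D t by have [] := hL 0%N I.
  split=> //; have k0 : 0 < k.+1%:R^-1 / 2 :> R by rewrite divr_gt0 ?invr_gt0.
  have [M hM] := eps_cvg0 (divr_gt0 k0 (ltr0n _ 2)).
  pose m := (n + M)%N; have [_ hm] := hL m I.
  have nUm : ~ U (N + m)%N t.
    by move=> h; apply: nU; apply: U_decr h; rewrite /m addnCA leq_addr.
  rewrite /= -[S t](subrK (Z (N + m)%N t)) addrC; apply: hm.
  have := S_close Dt nUm; have := hM (N + m)%N (leq_trans (leq_addl n M) (leq_addl N _)).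
  by move: k0; move: (k.+1%:R^-1) (eps _) (nrm _) => a b c; lra.
apply: measurableU; apply: measurableI => //; last exact: measurableC.
apply: measurableI => //; have [W0|nW0] := pselect (W 0).
  by rewrite (_ : [set _ | _] = setT)//; apply/seteqP; split.
by rewrite (_ : [set _ | _] = set0)//; apply/seteqP; split.
Qed.

(** Outside [U n] the limit is within [2 * eps n] of [Z n]; the factor [3] accommodates the strict
    inequality in [enl], and the added term is the mass of [U n]. *)
Lemma limit_law : exists m : Pmeas X, forall n (A : set (BX X)), measurable A ->
  (mu (D `&` [set t | A (Z n t)]) <= m (enl A (3 * eps n)) + (2 * eps n)%:E)%E.
Proof.
have mS (A : set (BX X)) : measurable A -> measurable (D `&` S @^-1` A).
  by move=> mA; exact: S_measurable.
have [||||m hm] := @probability_of_set_function R _ (BX X) (fun A => mu (D `&` S @^-1` A)).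
- by rewrite preimage_set0 setI0 measure0.
- by move=> A; exact: measure_ge0.
- move=> F mF tF mUF; rewrite preimage_bigcup setI_bigcupr.
  apply: measure_semi_sigma_additive.
  + by move=> n; exact: mS.
  + apply/trivIsetP => i j _ _ ij; move/trivIsetP: tF => /(_ i j I I ij) h.
    apply/seteqP; split=> t // [[_ hi] [_ hj]].
    by have : (F i `&` F j) (S t) by []; rewrite h.
  + by apply: bigcupT_measurable => n; exact: mS.
- by rewrite preimage_setT setIT lebesgue_measure_itv /= lte_fin ltr01 oppr0 adde0.
exists m => n A mA; rewrite hm.
have mEn := mS _ (enl_measurable A (3 * eps n)).
apply: (@le_trans _ _ (mu ((D `&` S @^-1` (enl A (3 * eps n))) `|` U n))); last first.
  have h := @measureU2 _ _ _ mu _ _ mEn (mU n); apply: (le_trans h).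
  by apply: leeD2l; exact: muU.
apply: le_measure; rewrite ?inE; [exact: mZ|exact: (measurableU _ _ mEn (mU n))|].
move=> t [Dt At]; have [|nU] := pselect (U n t); first by right.
left; split=> //; exists (Z n t) => //.
by have := S_close Dt nU; have := eps0 n; lra.
Qed.

End LimitLaw.

(** * The perturbation *)

Lemma sum_nat_of_bool_card (F : finType) (h : pred F) :
  (\sum_f (h f : nat) = #|h|)%N.
Proof.
rewrite -sum1_card [RHS]big_mkcond /=; apply: eq_bigr => f _.
by rewrite unfold_in; case: (h f).
Qed.

(** * Random sums with truncated angles *)

Section RandomAngles.
Variables (R : realType) (X : normedModType R[i]).
Local Notation mu := (@lebesgue_measure R).
Local Notation D := (`[0%R, 1%R[%classic : set R).
Implicit Types (W : seq (X * R[i])) (t : R).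

Definition ang q (j : nat) t : R := bsum R (fun r => dig (pickle (j, r)) t) q.

Lemma loB_gbits J q (j : 'I_J) t : loB R (gbits J q t j) = ang q j t.
Proof. by apply: eq_bigr => r _; rewrite !ffunE. Qed.

Lemma in01_ang q t : in01 (fun j => ang q j t).
Proof. by move=> j; rewrite -(@loB_gbits j.+1 q ord_max); exact: loB_in01. Qed.

Lemma ang_refine q q' j t : (q <= q')%N -> `|ang q' j t - ang q j t| <= 2 ^- q.
Proof.
move=> /(partial_sum_refine R (fun r => dig (pickle (j, r)) t)).
by rewrite -/(ang q j t) -/(ang q' j t) => /andP[h0 h1]; rewrite ger0_norm// ltW.
Qed.

Lemma lod_close q t : 0 <= t < 1 -> `|t - lod q t| <= 2 ^- q.
Proof.
move=> /(lod_itv q) /andP[h1 h2]; rewrite ger0_norm ?subr_ge0//.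
by rewrite lerBlDr addrC ltW.
Qed.

Definition rval W q t : X := lincomb W (fun j => chi (ang q j t)).

Lemma rvalE W q t :
  rval W q t = gval (fun j : 'I_(size W) => vec W j) (gbits (size W) q t).
Proof. by apply: eq_bigr => j _; rewrite loB_gbits. Qed.

Lemma rval_measurable W q (A : set X) : measurable (D `&` [set t | A (rval W q t)]).
Proof.
pose h (g : grid (size W) q) := `[< A (gval (fun j : 'I_(size W) => vec W j) g) >].
have := @gbits_measurable R _ _ h; congr (measurable (_ `&` _)).
by apply/seteqP; split=> t; rewrite /h /= rvalE => /asboolP.
Qed.

Lemma rval2_measurable W q W' q' (P : X -> X -> bool) :
  measurable (D `&` [set t | P (rval W q t) (rval W' q' t)]).
Proof.
pose Z t := (gbits (size W) q t, gbits (size W') q' t).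
pose h (g : grid (size W) q * grid (size W') q') :=
  P (gval (fun j : 'I_(size W) => vec W j) g.1) (gval (fun j : 'I_(size W') => vec W' j) g.2).
have := @finite_partition_measurable _ _ D _ Z _ h.
rewrite (_ : [set t | h (Z t)] = [set t | P (rval W q t) (rval W' q' t)]); last first.
  by apply/seteqP; split=> t; rewrite /h /= !rvalE.
apply=> -[g g'].
rewrite (_ : D `&` _ = (D `&` [set t | pred1 g (gbits (size W) q t)]) `&`
                       (D `&` [set t | pred1 g' (gbits (size W') q' t)])).
  by apply: measurableI; exact: gbits_measurable.
rewrite setIACA setIid; congr (_ `&` _); apply/seteqP; split=> t /=.
  by move=> [<- <-]; rewrite !eqxx.
by move=> [/eqP<- /eqP<-].
Qed.

(** With [q] digits per angle, the digits further on change a sum over [W] by less than [e / 2]. *)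
Definition mesh W (e : R) (q : nat) := exists2 k : R, 0 <= k &
  (forall s t : R, `|s - t| <= 2 ^- q -> cabs (chi s - chi t) <= k) /\ k * nsum W < e / 2.

Lemma mesh_exists W (e : R) (q0 : nat) : 0 < e ->
  exists q, [/\ (q0 <= q)%N, (0 < q)%N & mesh W e q].
Proof.
move=> e0; have n0 : 0 < nsum W + 1 by rewrite ltr_wpDl ?nsum_ge0.
have k0 : 0 < e / 2 / (nsum W + 1) by rewrite !divr_gt0.
have [d d0 hd] := chi_unif k0.
pose q := maxn q0 (Num.truncn d^-1).+1; exists q; split.
- exact: leq_maxl.
- by rewrite (leq_trans _ (leq_maxr _ _)).
exists (e / 2 / (nsum W + 1)); first exact: ltW.
split=> [s t st|]; last by rewrite mulrAC ltr_pdivrMr// ltr_pM2l ?divr_gt0// ltrDl.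
apply: hd; apply: (le_lt_trans st); rewrite invf_plt ?posrE ?exprn_gt0//.
rewrite (lt_le_trans (truncnS_gt _))// -natrX ler_nat.
by rewrite (leq_trans (leq_maxr q0 _))// ltnW// ltn_expl.
Qed.

(** The increment has two sources: further digits in the angles of [W], costing less than [e / 2] by
    [mesh], and the new vectors [v], which type [p] and Markov's inequality keep below [e / 2] off a
    set of mass at most [e]. *)
Lemma rval_increment (p K : R) W v (e : R) q q' : 0 < p -> 0 < e -> mesh W e q ->
  (q <= q')%N ->
  (forall x : 'I_(size (W ++ v)) -> X, \sum_(g : grid (size (W ++ v)) q') nrm (gval x g) `^ p <=
     2 ^+ (size (W ++ v) * q') * (K * \sum_j nrm (x j) `^ p)) ->
  K * psum p v / (e / 2) `^ p <= e ->
  (mu (D `&` [set t | (e <= nrm (rval W q t - rval (W ++ v) q' t))%R]) <= e%:E)%E.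
Proof.
move=> p0 e0 [k k0 [hk kW]] qq' hK hv.
have e2 : 0 < e / 2 by rewrite divr_gt0.
(* Setting the vectors of [W] to zero isolates the contribution of [v] on the common grid. *)
pose y (j : 'I_(size (W ++ v))) : X := if (j < size W)%N then 0 else vec (W ++ v) j.
have yE : \sum_j nrm (y j) `^ p = psum p v.
  have -> : \sum_j nrm (y j) `^ p =
     \sum_(j < size W + size v) (if (j < size W)%N then 0 else nrm (vec (W ++ v) j) `^ p).
    rewrite -(big_mkord xpredT (fun j => if (j < size W)%N then 0 else nrm (vec (W ++ v) j) `^ p)).
    rewrite -size_cat big_mkord; apply: eq_bigr => j _; rewrite /y.
    by case: ifP => // _; rewrite nrm0 powR0 ?gt_eqF.
  rewrite big_split_ord /= big1 ?add0r => [|i _]; last by rewrite ltn_ord.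
  by apply: eq_bigr => i _; rewrite ltnNge leq_addr /= vec_cat ltnNge leq_addr /= addKn.
have := grid_markov e2 p0 (hK y); rewrite yE => /le_trans h.
apply: (@le_trans _ _ (mu (D `&` [set t | (e / 2 <= nrm (gval y (gbits (size (W ++ v)) q' t)))%R]))); last first.
  by apply: h; rewrite lee_fin.
apply: le_measure; rewrite ?inE.
- exact: (rval2_measurable W q (W ++ v) q' (fun a b => e <= nrm (a - b))).
- exact: (@gbits_measurable R _ _ (fun g => e / 2 <= nrm (gval y g))).
move=> t [Dt /= et]; split=> //=.
have yv : gval y (gbits (size (W ++ v)) q' t) = lincomb v (fun i => chi (ang q' (size W + i)%N t)).
  have -> : gval y (gbits (size (W ++ v)) q' t) = \sum_(j < size W + size v)
     (if (j < size W)%N then 0 else chi (ang q' j t) *: vec (W ++ v) j).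
    rewrite -(big_mkord xpredT (fun j => if (j < size W)%N then 0 else
       chi (ang q' j t) *: vec (W ++ v) j)).
    rewrite -size_cat big_mkord; apply: eq_bigr => j _; rewrite /y loB_gbits.
    by case: ifP => // _; rewrite scaler0.
  rewrite big_split_ord /= big1 ?add0r => [|i _]; last by rewrite ltn_ord.
  by apply: eq_bigr => i _; rewrite ltnNge leq_addr /= vec_cat ltnNge leq_addr /= addKn.
have lip : nrm (rval W q t - rval W q' t) <= k * nsum W.
  by apply: lincomb_lip => j _; apply: hk; rewrite distrC; exact: ang_refine.
move: et; rewrite {2}/rval lincomb_cat -/(rval W q' t) -yv opprD addrA => et.
have := nrmD (rval W q t - rval W q' t) (- gval y (gbits (size (W ++ v)) q' t)).
rewrite nrmN; move: et lip kW; move: (nrm _) (nrm _) (nrm _) (k * _) => a b c f.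
lra.
Qed.

End RandomAngles.

(** * Inductive construction of the perturbed law *)

Section Construction.
Variables (R : realType) (X : completeNormedModType R[i]) (T : {linear X -> X}) (p : R).
Hypotheses (cT : continuous T) (p1 : 1 < p) (Xp : has_type X p).
Variable C0 : R.
Hypothesis hC0 : forall Omega : set X,
  open Omega -> Omega !=set0 -> T @^-1` Omega `<=` Omega ->
  exists (n : nat) (u : 'I_n -> X) (lam : 'I_n -> R[i]),
    (forall k, unimodular_eigen T (u k) (lam k)) /\
    independent_family lam /\
    Omega (\sum_(k < n) u k) /\
    \sum_(k < n) (nrm (u k)) `^ p <= C0.
Variable d : nat -> X.
Hypothesis hd : forall x e, 0 < e -> exists k, nrm (x - d k) < e.
Local Notation mu := (@lebesgue_measure R).
Local Notation D := (`[0%R, 1%R[%classic : set R).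

Definition steinhaus_of (w : seq (X * R[i])) (m : Pmeas X) :=
  forall A : set (BX X), measurable A -> m A = iter_int (size w)
    (fun th => (\1_A (lincomb w (fun j => chi (th j)) : BX X))%:E).

Lemma steinhaus_family m : steinhaus T m ->
  exists2 w, eigfam T w & steinhaus_of w m.
Proof.
move=> [n [x [hx hm]]]; have [lam hlam] := choice hx.
pose w := [seq (x j, lam j) | j <- enum 'I_n].
have sw : size w = n by rewrite size_map size_enum_ord.
exists w; first by move=> _ /mapP[j _ ->]; exact: hlam.
move=> A mA; rewrite hm//.
have valE c : lincomb w c = \sum_(j < n) c j *: x j.
  rewrite /lincomb -(big_mkord xpredT (fun i => c i *: vec w i)) sw big_mkord.
  apply: eq_bigr => j _; congr (_ *: _).
  by rewrite /vec (nth_map j) ?size_enum_ord// nth_ord_enum.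
rewrite sw; congr iter_int; apply/funext => th.
by rewrite valE.
Qed.

Lemma steinhaus_of_steinhaus w m : eigfam T w -> steinhaus_of w m -> steinhaus T m.
Proof.
move=> ew hm; exists (size w), (fun j => vec w j); split=> // j.
by exists (evals w)`_j; exact: eigfam_nth.
Qed.

Let target (n : nat) : X * R := if @unpickle (nat * nat * nat)%type n is Some q
  then (d q.1.1, q.1.2.+1%:R^-1) else (0, 1).

Let target_gt0 n : 0 < (target n).2.
Proof. by rewrite /target; case: unpickle => [q|] //=; rewrite invr_gt0. Qed.

(** A state holds the current family, its tolerance and the number of digits used per angle. *)
Let state := (seq (X * R[i]) * R * nat)%type.
Let inv (s : state) := [/\ eigfam T s.1.1, 0 < s.1.2, (0 < s.2)%N & mesh s.1.1 s.1.2 s.2].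

(** The second condition bounds the increment in probability; the margin [3 * s'.1.2] in the last is
    the enlargement lost in passing to the limit law. *)
Let step K n (s s' : state) := exists v, [/\ s'.1.1 = s.1.1 ++ v,
  K * psum p v / (s.1.2 / 2) `^ p <= s.1.2, s'.1.2 <= s.1.2 / 2, (s.2 <= s'.2)%N &
  forall t, in01 t ->
    inner (visit T (target n).1 (target n).2) (3 * s'.1.2) (lincomb s'.1.1 (fun j => chi (t j)))].

Let step_exists K n (s : state) : 0 <= K -> inv s -> exists s', inv s' /\ step K n s s'.
Proof.
case: s => [[W e] q] K0 [/= eW e0 q0 mW].
have p0 : 0 < p by exact: lt_trans p1.
pose c := e * (e / 2) `^ p / (K + 1).
have e2 : 0 < (e / 2) `^ p by rewrite powR_gt0// divr_gt0.
have K1 : 0 < K + 1 by rewrite ltr_wpDl.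
have c0 : 0 < c by rewrite divr_gt0// mulr_gt0.
have [v [ev pv [rho rho0 hrho]]] :=
  step_margin p1 Xp cT hC0 (target n).1 eW (target_gt0 n) c0.
(* The bound [rho / 3] makes the margin [3 * e'] at most [rho]. *)
pose e' := Num.min (e / 2) (rho / 3).
have e'0 : 0 < e' by rewrite lt_min !divr_gt0.
have [q' [qq' q'0 mW']] := mesh_exists (W ++ v) q e'0.
exists (W ++ v, e', q'); split; first by split => //; exact: eigfam_cat.
exists v; split=> //=.
- rewrite ler_pdivrMr//; apply: (@le_trans _ _ ((K + 1) * c)).
    apply: ler_pM => //; last by rewrite lerDl.
    by apply: sumr_ge0 => i _; exact: powR_ge0.
  by rewrite /c mulrC mulfVK// gt_eqF.
- by rewrite ge_min lexx.
- move=> t t01 z hz; have [|N hN] := hrho t t01 z; last by exists N.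
  apply: (lt_le_trans hz); rewrite -ler_pdivlMl// mulrC.
  by rewrite ge_min lexx orbT.
Qed.

Let code (k j l : nat) : nat := @pickle (nat * nat * nat)%type (k, j, l).

(** By the pigeonhole principle [N + 1] repetition indices cannot share [N] codes, so each ball is a
    target at arbitrarily late stages. *)
Let code_unbounded (k j N : nat) : exists l, (N <= code k j l)%N.
Proof.
apply: contrapT => /forallNP h.
have lt l : (code k j l < N)%N by rewrite ltnNge; apply/negP.
have finj : injective (fun l : 'I_N.+1 => Ordinal (lt l)).
  move=> l l' [] /(pcan_inj (@pickleK (nat * nat * nat)%type)) [] ll'.
  exact: val_inj.
by have := leq_card _ finj; rewrite !card_ord ltnn.
Qed.

Let state_sequence K (s0 : state) : 0 <= K -> inv s0 -> exists St : nat -> state,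
  [/\ St 0%N = s0, forall n, inv (St n) & forall n, step K n (St n) (St n.+1)].
Proof.
move=> K0 inv0.
have next (x : nat * {s | inv s}) : exists y : {s | inv s}, step K x.1 (sval x.2) (sval y).
  by case: x => n [s is_]; have [s' [is' st]] := step_exists n K0 is_; exists (exist _ s' is').
have [F hF] := choice next.
pose S := fix S n : {s | inv s} := if n is n'.+1 then F (n', S n') else exist _ s0 inv0.
exists (fun n => sval (S n)); split=> // n; first exact: (svalP (S n)).
exact: (hF (n, S n)).
Qed.

(** The limit law is within [4 * eps n] of the Steinhaus law of stage [n]: [eps n] for truncating
    the angles, [3 * eps n] for the limit. Stage [0], with tolerance [e / 4], gives closeness to
    [s]; late stages put the limit in [Sbar T]. *)
Lemma hypercyclic_perturbation (s : Pmeas X) (e : R) : 0 < e -> steinhaus T s ->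
  exists2 m, SbarA T (HC T) m & pclose s m e.
Proof.
move=> e0 /steinhaus_family[w ew hs].
have a34 (a : R) : a + 3 * a <= 4 * a by lra.
have p0 : 0 < p by exact: lt_trans p1.
have [K K0 hK] := type_grid Xp.
have e4 : 0 < e / 4 by rewrite divr_gt0.
have [q0 [_ q00 mw]] := mesh_exists w 0 e4.
have inv0 : inv (w, e / 4, q0) by [].
have [St [St0 Sinv Sstep]] := state_sequence K0 inv0.
pose W n := (St n).1.1; pose eps n := (St n).1.2; pose q n := (St n).2.
have hinv n : [/\ eigfam T (W n), 0 < eps n, (0 < q n)%N & mesh (W n) (eps n) (q n)].
  exact: Sinv.
have hstep n : step K n (St n) (St n.+1) by exact: Sstep.
have W0 : W 0%N = w by rewrite /W St0.
have eps00 : eps 0%N = e / 4 by rewrite /eps St0.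
have eps0 n : 0 < eps n by have [] := hinv n.
have epsS n : eps n.+1 <= eps n / 2 by have [v []] := hstep n.
pose Z n t := rval (W n) (q n) t.
have mZ n (A : set X) : measurable (D `&` [set t | A (Z n t)]) by exact: rval_measurable.
have mB n : measurable (D `&` [set t | eps n <= nrm (Z n t - Z n.+1 t)]).
  exact: (rval2_measurable (W n) (q n) (W n.+1) (q n.+1) (fun a b => eps n <= nrm (a - b))).
have muB n : (mu (D `&` [set t | (eps n <= nrm (Z n t - Z n.+1 t))%R]) <= (eps n)%:E)%E.
  have [v [Wv pv _ qq' _]] := hstep n; have [_ _ _ mW] := hinv n.
  rewrite /Z -/(W n.+1) in Wv *; rewrite Wv; apply: (rval_increment p0 (eps0 n) mW qq' _ pv).
  move=> x; have [_ _ + _] := hinv n.+1; rewrite -/(q n.+1).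
  by move: (q n.+1) => [//|q'] _; exact: hK.
have [m hm] := limit_law mZ eps0 epsS mB muB.
have eps_small := eps_cvg0 eps0 epsS.
have close n nu : steinhaus_of (W n) nu -> pclose nu m (4 * eps n).
  move=> hnu; apply: pclose_one_sided => A mA; have [_ _ _ [k k0 [hk kW]]] := hinv n.
  have hk' t : 0 <= t < 1 -> cabs (chi t - chi (lod (q n) t)) <= k.
    by move=> t01; apply: hk; exact: lod_close.
  have kW' : k * \sum_(j < size (W n)) nrm (vec (W n) j) < eps n.
    by rewrite (lt_trans kW)// ltr_pdivrMr// ltr_pMr// ltr1n.
  apply: (le_trans (steinhaus_grid hd k0 hk' hnu kW' mA)).
  pose h (g : grid (size (W n)) (q n)) : bool :=
    `[< enl A (eps n) (gval (fun j : 'I_(size (W n)) => vec (W n) j) g) >].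
  have hE : (\sum_(g : grid (size (W n)) (q n)) (h g)%:R * 2 ^- (size (W n) * q n))%:E =
            mu (D `&` [set t | enl A (eps n) (Z n t)]).
    rewrite (_ : [set t | _] = [set t | h (gbits (size (W n)) (q n) t)]).
      have -> : mu (D `&` [set t | h (gbits (size (W n)) (q n) t)]) = _ := gbits_measure R h.
      by rewrite -mulr_suml -natr_sum sum_nat_of_bool_card.
    by apply/seteqP; split=> t; rewrite /h /= /Z rvalE => /asboolP.
  rewrite [leLHS]hE; apply: (le_trans (hm n _ (enl_measurable A (eps n)))); apply: leeD.
    rewrite le_measure ?inE; [|exact: enl_measurable..|] => //.
    apply: (subset_trans (@enl_enl _ _ _ _ _)).
    by apply: enl_sub => //; exact: a34.
  by rewrite lee_fin ler_pM2r// ler_nat.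
exists m; last first.
  have := close 0%N s; rewrite W0 eps00 (_ : 4 * (e / 4) = e); first exact.
  by rewrite mulrC mulfVK// pnatr_eq0.
split.
  move=> e' e'0; have [n hn] := eps_small (e' / 4) (divr_gt0 e'0 (ltr0n _ 4)).
  have [nu hnu] := steinhaus_law hd (fun j : 'I_(size (W n)) => vec (W n) j).
  exists nu; first by apply: (@steinhaus_of_steinhaus (W n)) => //; have [] := hinv n.
  exists (4 * eps n).
    by rewrite mulr_gt0//= mulrC -ltr_pdivlMr// hn.
  by move=> A mA; have [h1 h2] := close n nu hnu A mA; split.
rewrite (HC_bigcap T hd); apply/(prob_bigcap_open m).
  by move=> i; case: unpickle => [u|]; [exact: visit_open|exact: openT].
move=> i; case: unpickle => [[[k j] l]|]; last exact: probability_setT.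
rewrite /=; set V := visit T _ _.
have mV : measurable (V : set (BX X)) by apply: open_measurable_BX; exact: visit_open.
apply/eqP; rewrite eq_le probability_le1//= prE// lee_fin; apply/ler_addgt0Pr => e' e'0.
have [N hN] := eps_small (e' / 2) (divr_gt0 e'0 (ltr0n _ 2)).
(* At a late stage aiming at the ball [(k, j)], all values of [Z n.+1] lie in [V] with margin, so
   [V] has limit probability at least [1 - 2 * eps n.+1]. *)
have [l' hl'] := code_unbounded k j N; set n := code k j l' in hl'.
have [v [_ _ _ _]] := hstep n; rewrite /target pickleK /= -/V -/(W n.+1) -/(eps n.+1) => hin.
have := hm n.+1 _ (inner_measurable V (3 * eps n.+1)).
rewrite (_ : D `&` _ = D); last first.
  by apply/setIidPl => t _ /=; apply: (hin (fun j => ang (q n.+1) j t)); exact: in01_ang.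
rewrite lebesgue_measure_itv /= lte_fin ltr01 oppr0 adde0.
have mE := enl_measurable (inner V (3 * eps n.+1)) (3 * eps n.+1).
rewrite prE// -EFinD lee_fin => h1.
have h2 := pr_le m mE mV (@enl_inner _ _ V (3 * eps n.+1)).
have h3 : eps n.+1 < e' / 2 by apply: hN; rewrite (leq_trans hl').
apply: (le_trans h1); apply: (lerD h2).
by rewrite mulrC -ler_pdivlMr// ltW.
Qed.

End Construction.

(** * The [G_delta] property and density *)

Theorem proposition5 (R : realType) (X : completeNormedModType R[i])
  (T : {linear X -> X}) (p : R) :
  separable_space X ->
  continuous T ->
  1 < p <= 2 ->
  has_type X p ->
  (exists C : R, forall Omega : set X,
      open Omega -> Omega !=set0 -> T @^-1` Omega `<=` Omega ->
      exists (n : nat) (u : 'I_n -> X) (lam : 'I_n -> R[i]),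
        (forall k, unimodular_eigen T (u k) (lam k)) /\
        independent_family lam /\
        Omega (\sum_(k < n) u k) /\
        \sum_(k < n) (nrm (u k)) `^ p <= C) ->
  pGdelta_in (Sbar T) (SbarA T (HC T)) /\ pdense_in (Sbar T) (SbarA T (HC T)).
Proof.
move=> /separable_seq[d hd] cT /andP[p1 _] Xp [C0 hC0]; split.
  rewrite /SbarA (HC_bigcap T hd); apply: pGdelta_prob1 => i.
  by case: unpickle => [u|]; [exact: visit_open|exact: openT].
split=> [m []//|m Sm e e0]; have e2 : 0 < e / 2 by rewrite divr_gt0.
have e4 : 0 < e / 4 by rewrite divr_gt0.
have [s hs [e1 /andP[e10 e1e] ms]] := Sm _ e2.
have [m' hm' sm'] := hypercyclic_perturbation cT p1 Xp hC0 hd e4 hs.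
exists m' => //; exists (e1 + e / 4); last exact: pclose_trans sm'.
by move: e1e; rewrite addr_gt0//=; lra.
Qed.
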